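(* (Wick theorem) Let $d\in\mathbb N$ and let $\Phi_d\in(\mathcal M^{2d})'$ be the Hida distribution with $T$-transform $T\Phi_d(F,G)=\exp\left(-i\sum_{\mu=1}^dTr(F_\mu G_\mu)\right)$, $(F,G)\in\mathcal M^{2d}$. Let $m\in\mathbb N$ and let $F_1,\ldots,F_{2m}\in\mathcal M^{2d}$. Then $$\langle\!\langle\Phi_d,\langle\cdot,F_1\rangle\cdots\langle\cdot,F_{2m}\rangle\rangle\!\rangle=\sum_{\text{pairings}}\langle\!\langle\Phi_d,\langle\cdot,F_{k_1}\rangle\langle\cdot,F_{l_1}\rangle\rangle\!\rangle\cdots\langle\!\langle\Phi_d,\langle\cdot,F_{k_m}\rangle\langle\cdot,F_{l_m}\rangle\rangle\!\rangle,$$ where the sum is over all $(2m)!/(2^mm!)$ ways of writing $1,\ldots,2m$ as $m$ distinct (unordered) pairs $(k_1,l_1),\ldots,(k_m,l_m)$.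
   Context: Matrix spaces. $\mathcal T$ is the real Hilbert space of Hermitian Hilbert–Schmidt operators on an infinite-dimensional separable complex Hilbert space, represented via a fixed orthonormal basis as infinite Hermitian matrices $(a_{ij})_{i,j\in\mathbb N}$, with inner product $(A,B)=Tr(BA)$. $\mathcal M\subset\mathcal T$ is the subspace of matrices with only finitely many nonzero entries, with the nuclear topology given as the projective limit of the weighted Hilbert spaces $\mathcal T_p$ with norms $|F|_p^2=\sum_{i,j}p_{ij}|F_{ij}|^2$, over all symmetric weights $p=(p_{ij})$ with $p_{ij}\ge1$. Its dual $\mathcal M'$ is the space of all infinite Hermitian matrices, with pairing $\langle A,F\rangle=\sum_{i,j}A_{ij}F_{ji}$ extending $(\cdot,\cdot)$. $\mathcal M^{2d}\subset\mathcal T^{2d}\subset{\mathcal M'}^{2d}$ are the $2d$-fold products, with pairing and inner product summed over components; elements are written $(F,G)$ with $F=(F_\mu)_{\mu=1}^d$, $G=(G_\mu)_{\mu=1}^d$. $\mu_d$ is the standard Gaussian measure on ${\mathcal M'}^{2d}$, with characteristic function $\int\exp(i\langle A,F\rangle)\,d\mu_d(A)=\exp(-\frac12|F|^2)$, $F\in\mathcal M^{2d}$. Hida triple $(\mathcal M^{2d})\subset L^2(\mu_d)\subset(\mathcal M^{2d})'$. Wick monomials are defined by $\exp(\langle A,F\rangle-\frac12|F|^2)=\sum_{n\ge0}\frac1{n!}\langle:A^{\otimes n}:,F^{\otimes n}\rangle$, and each $f\in L^2(\mu_d)$ has a unique chaos decomposition $f=\sum_n\langle:A^{\otimes n}:,f^{(n)}\rangle$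 with $f^{(n)}$ in the symmetric tensor power $(\mathcal T^{2d}_{\mathbb C})^{\hat\otimes n}$. The space of test functions $(\mathcal M^{2d})$ is the projective limit, over weights $p$ and $q\in\mathbb N$, of the Hilbert spaces given by the norms $\|\varphi\|_{p,q}^2=\sum_nn!\,2^{nq}|\varphi^{(n)}|_p^2$; it contains all polynomials in the functions $\langle\cdot,F\rangle$, $F\in\mathcal M^{2d}$. Its topological dual $(\mathcal M^{2d})'$ is the space of Hida distributions, with bilinear dual pairing $\langle\!\langle\cdot,\cdot\rangle\!\rangle$ extending $\langle\!\langle f,\varphi\rangle\!\rangle=\int f\varphi\,d\mu_d$. The $T$-transform of $\Phi\in(\mathcal M^{2d})'$ is $T\Phi(F)=\langle\!\langle\Phi,\exp(i\langle\cdot,F\rangle)\rangle\!\rangle$, $F\in\mathcal M^{2d}$; it determines $\Phi$ uniquely, and a Hida distribution $\Phi_d$ with the $T$-transform in the claim exists. *)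

(* Defs.v *)
From HB Require Import structures.
From mathcomp Require Import all_boot all_order all_fingroup all_algebra.
From mathcomp Require Import all_classical all_reals all_analysis.
From mathcomp Require Import complex.

Set Implicit Arguments.
Unset Strict Implicit.
Unset Printing Implicit Defensive.

Import Order.TTheory GRing.Theory Num.Theory.
Import numFieldNormedType.Exports.

Local Open Scope classical_set_scope.
Local Open Scope complex_scope.
Local Open Scope ring_scope.

(* The exponential on R[i], which MathComp-Analysis only provides on R. *)
Definition cexp (R : realType) (z : R[i]) : R[i] :=
  (expR (complex.Re z) * cos (complex.Im z))
    +i* (expR (complex.Re z) * sin (complex.Im z)).

(* R[i] carries no canonical topology here: convergence is stated through the
   R-valued modulus. *)
Definition ccvg (R : realType) (u : nat -> R[i]) (l : R[i]) : Prop :=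
  (fun N => Normc.normc (u N - l)) @ \oo --> (0 : R).

(* M' : all infinite Hermitian matrices. *)
Record hermitian (R : realType) := Hermitian {
  entry :> nat -> nat -> R[i];
  entryJ : forall i j, entry j i = (entry i j)^*%C }.

HB.instance Definition _ (R : realType) := gen_eqMixin (hermitian R).
HB.instance Definition _ (R : realType) := gen_choiceMixin (hermitian R).

Lemma herm0_subproof (R : realType) (i j : nat) : (0 : R[i]) = (0 : R[i])^*%C.
Proof. by rewrite rmorph0. Qed.

HB.instance Definition _ (R : realType) :=
  isPointed.Build (hermitian R)
    (Hermitian (entry := fun _ _ => 0) (@herm0_subproof R)).

(* M'^{2d}.  An element (F, G) is one family F on 'I_d + 'I_d, with
   F_mu = F (inl mu) and G_mu = F (inr mu). *)
Notation component d := ('I_d + 'I_d)%type.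
Definition Mdual (R : realType) (d : nat) : Type := component d -> hermitian R.

(* M^{2d}, as a subset of M'^{2d}. *)
Definition Mfin (R : realType) (d : nat) : set (Mdual R d) :=
  [set F | forall c, finite_set [set ij : nat * nat | F c ij.1 ij.2 != 0]].

(* The sums \sum_(x \in setT) below range over infinite index sets; they are
   only used for terms of finite support. *)
Definition pairing (R : realType) (d : nat) (A F : Mdual R d) : R[i] :=
  \sum_(c : component d) \sum_(ij \in [set: nat * nat])
    A c ij.1 ij.2 * F c ij.2 ij.1.

Definition matmul (R : realType) (A B : nat -> nat -> R[i]) (i k : nat) :
    R[i] :=
  \sum_(j \in [set: nat]) A i j * B j k.

Definition mattr (R : realType) (A : nat -> nat -> R[i]) : R[i] :=
  \sum_(i \in [set: nat]) A i i.

(* The cylinder sigma-algebra of M'^{2d}; the pairing <A, F> is real, so that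
   taking its real part loses nothing. *)
Definition cylinders (R : realType) (d : nat) : set (set (Mdual R d)) :=
  [set C | exists (F : Mdual R d) (B : set R),
    [/\ Mfin F, measurable B &
        C = (fun A => complex.Re (pairing A F)) @^-1` B]].

Notation Omega R d := (g_sigma_algebraType (@cylinders R d)).

Definition cintegral (R : realType) (d : nat) (mu : probability (Omega R d) R)
    (f : Mdual R d -> R[i]) : R[i] :=
  Rintegral mu setT (fun A => complex.Re (f A))
    +i* Rintegral mu setT (fun A => complex.Im (f A)).

(* For F in M^{2d}, |F|^2 = (F, F) = <F, F>. *)
Definition standard_gaussian (R : realType) (d : nat)
    (mu : probability (Omega R d) R) : Prop :=
  forall F : Mdual R d, Mfin F ->
    cintegral mu (fun A => cexp ('i%C * pairing A F)) =
    cexp (- (pairing F F / 2)).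

Definition L2 (R : realType) (d : nat) (mu : probability (Omega R d) R)
    (f : Mdual R d -> R[i]) : Prop :=
  [/\ measurable_fun setT (fun A : Omega R d => complex.Re (f A)),
      measurable_fun setT (fun A : Omega R d => complex.Im (f A)) &
      (\int[mu]_A ((Normc.normc (f A) ^+ 2)%:E) < +oo)%E].

Definition L2cvg (R : realType) (d : nat) (mu : probability (Omega R d) R)
    (u : nat -> Mdual R d -> R[i]) (f : Mdual R d -> R[i]) : Prop :=
  (fun N => (\int[mu]_A ((Normc.normc (u N A - f A) ^+ 2)%:E))%E)
    @ \oo --> 0%E.

(* Tensors of order n over the complexified matrices: the index (c, i, j) is
   the entry (i, j) of the component c.  The complexification of the Hermitian
   Hilbert-Schmidt matrices is the space of all complex Hilbert-Schmidt
   matrices, so the n-th Hilbert tensor power of T^{2d}_C is the space of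
   square-summable tensors. *)
Notation multi_index d := (component d * nat * nat)%type.
Notation tensor R d n := (n.-tuple (multi_index d) -> R[i]).

Definition coord (R : realType) (d : nat) (F : Mdual R d)
    (x : multi_index d) : R[i] :=
  F x.1.1 x.1.2 x.2.

Definition swap_index (d : nat) (x : multi_index d) : multi_index d :=
  (x.1.1, x.2, x.1.2).

Definition tpow (R : realType) (d n : nat) (F : Mdual R d) : tensor R d n :=
  fun x => \prod_(a < n) coord F (tnth x a).
Arguments tpow {R d} n F x.

Definition symmetric_tensor (R : realType) (d n : nat) (k : tensor R d n) :
    Prop :=
  forall (s : 'S_n) (x : n.-tuple (multi_index d)),
    k [tuple tnth x (s a) | a < n] = k x.

(* Bilinear pairing of tensors, extending <A^{(x)n}, F^{(x)n}> = <A, F>^n; used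
   for v of finite support. *)
Definition tpairing (R : realType) (d n : nat) (u v : tensor R d n) : R[i] :=
  \sum_(x \in [set: n.-tuple (multi_index d)])
    u x * v (map_tuple (@swap_index d) x).

(* @W n A is the Wick power :A^{(x)n}:.  Symmetric tensors are determined by
   their pairings with the powers F^{(x)n}, F in M^{2d}, so that there is
   exactly one W with this generating function. *)
Definition wick_monomials (R : realType) (d : nat)
    (W : forall n, Mdual R d -> tensor R d n) : Prop :=
  (forall n A, symmetric_tensor (@W n A)) /\
  (forall A F : Mdual R d, Mfin F ->
    ccvg (fun N => \sum_(n < N) (n`!%:R)^-1 * tpairing (@W n A) (tpow n F))
         (cexp (pairing A F - pairing F F / 2))).

(* Weights p, and |k|_p^2 on tensors of order n. *)
Definition weight (R : realType) (p : nat -> nat -> R) : Prop :=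
  (forall i j, p i j = p j i) /\ (forall i j, 1 <= p i j).

Definition tnorm2 (R : realType) (d n : nat) (p : nat -> nat -> R)
    (k : tensor R d n) : \bar R :=
  (\esum_(x in [set: n.-tuple (multi_index d)])
    ((\prod_(a < n) p (tnth x a).1.2 (tnth x a).2)
      * Normc.normc (k x) ^+ 2)%:E)%E.

Definition fock_kernel (R : realType) (d n : nat) (k : tensor R d n) : Prop :=
  symmetric_tensor k /\ (tnorm2 (fun _ _ => 1%R) k < +oo)%E.

Definition truncate (R : realType) (d n : nat) (k : tensor R d n) (K : nat) :
    tensor R d n :=
  fun x => if [forall a, ((tnth x a).1.2 < K)%N && ((tnth x a).2 < K)%N]
           then k x else 0.

(* g = <:A^{(x)n}:, k> in L^2(mu), the limit over finitely supported
   truncations of k, for which the pairing is a finite sum. *)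
Definition wick_integral (R : realType) (d : nat) (mu : probability (Omega R d) R)
    (W : forall n, Mdual R d -> tensor R d n) (n : nat) (k : tensor R d n)
    (g : Mdual R d -> R[i]) : Prop :=
  L2 mu g /\ L2cvg mu (fun K A => tpairing (@W n A) (truncate k K)) g.

(* f = \sum_n <:A^{(x)n}:, k n> in L^2(mu). *)
Definition chaos (R : realType) (d : nat) (mu : probability (Omega R d) R)
    (W : forall n, Mdual R d -> tensor R d n)
    (f : Mdual R d -> R[i]) (k : forall n, tensor R d n) : Prop :=
  [/\ L2 mu f,
      forall n, fock_kernel (@k n) &
      exists g : nat -> Mdual R d -> R[i],
        (forall n, wick_integral mu W (@k n) (g n)) /\
        L2cvg mu (fun N A => \sum_(n < N) g n A) f].

Definition fock_norm2 (R : realType) (d : nat) (p : nat -> nat -> R) (q : nat)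
    (k : forall n, tensor R d n) : \bar R :=
  (\sum_(0 <= n <oo) ((n`! * 2 ^ (n * q))%N%:R)%:E * tnorm2 p (@k n))%E.

(* ||f||_{p,q}^2.  By uniqueness of the chaos decomposition the infimum is over
   a single value when f is in L^2(mu), and it is +oo otherwise. *)
Definition hida_norm2 (R : realType) (d : nat) (mu : probability (Omega R d) R)
    (W : forall n, Mdual R d -> tensor R d n) (p : nat -> nat -> R) (q : nat)
    (f : Mdual R d -> R[i]) : \bar R :=
  ereal_inf [set fock_norm2 p q k | k in [set k | chaos mu W f k]].

(* (M^{2d}), as a set of functions on M'^{2d} rather than of classes modulo
   mu; a.e. equal functions are at distance 0 for every norm. *)
Definition test_function (R : realType) (d : nat) (mu : probability (Omega R d) R)
    (W : forall n, Mdual R d -> tensor R d n) : set (Mdual R d -> R[i]) :=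
  [set f | forall (p : nat -> nat -> R) (q : nat), weight p ->
    (hida_norm2 mu W p q f < +oo)%E].

(* (M^{2d})': linear functionals on (M^{2d}), continuous for the projective
   limit topology.  The norms ||.||_{p,q} are directed, so their balls form
   bases of neighborhoods.  Phi f stands for <<Phi, f>>, and is only meaningful
   when f is a test function. *)
Definition hida_distribution (R : realType) (d : nat)
    (mu : probability (Omega R d) R) (W : forall n, Mdual R d -> tensor R d n)
    (Phi : (Mdual R d -> R[i]) -> R[i]) : Prop :=
  (forall (a : R[i]) (f g : Mdual R d -> R[i]),
    test_function mu W f -> test_function mu W g ->
    Phi (fun A => a * f A + g A) = a * Phi f + Phi g) /\
  (forall f : Mdual R d -> R[i], test_function mu W f ->
    forall e : R, 0 < e ->
    exists (p : nat -> nat -> R) (q : nat) (delta : R),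
      [/\ weight p, 0 < delta &
        forall g : Mdual R d -> R[i], test_function mu W g ->
          (hida_norm2 mu W p q (fun A => g A - f A)%R
             < (delta ^+ 2)%:E)%E ->
          Normc.normc (Phi g - Phi f) < e]).

Definition T_transform (R : realType) (d : nat)
    (Phi : (Mdual R d -> R[i]) -> R[i]) (F : Mdual R d) : R[i] :=
  Phi (fun A => cexp ('i%C * pairing A F)).

Definition perfect_pairing (n : nat) (P : {set {set 'I_n}}) : bool :=
  finset.partition P (finset.setT : {set 'I_n}) && [forall B in P, #|B| == 2%N].

(* Main.v *)
(* By polarization, a product of 2m linear functionals is a signed combination of
   the powers <., F_S>^(2m), F_S being the sum of the F_k over a subset S.  On a
   ray, exp(i t <A, F>) is the sum of (i t)^n exp(-a t^2) h_n(<A, F>), where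
   a = |F|^2 / 2 and n! h_n is the n-th Hermite polynomial of variance 2 a; this
   is its chaos decomposition, the series converges for all the Hida norms, and
   comparing the powers of t in the T-transform yields every <<Phi, h_n>>, whence
   <<Phi, <., F>^(2m)>> = (2m)! / (2^m m!) <<Phi, <., F>^2>>^m.  Expanding the
   quadratic form <<Phi, <., F_S>^2>>, inclusion-exclusion over S only leaves the
   perfect pairings.

   The Gaussian measure is only known through its characteristic function.  Finite
   differences of the latter and Fatou's lemma bound the even moments, so that
   exp(s |<A, F>|) is integrable for every s; this dominates the Hermite series. *)
Require Import Defs.
From mathcomp Require Import all_boot all_order all_fingroup all_algebra.
From mathcomp Require Import all_classical all_reals all_analysis.
From mathcomp Require Import complex.

From mathcomp Require Import measurable_realfun ring lra zify.

Import Order.TTheory GRing.Theory Num.Theory.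
Import numFieldNormedType.Exports.
Import Normc.
Local Open Scope complex_scope.
Local Open Scope ring_scope.

Set Implicit Arguments.
Unset Strict Implicit.
Unset Printing Implicit Defensive.

(** [W] is given through its generating function, so Wick powers are computable only against the
    powers of a single field, that is along rays. This forces the detour through polarization: a
    product of different functionals does not live on one ray. [Phi] in turn is linear and
    continuous on test functions only, so each function it meets needs an explicit chaos
    decomposition, converging in L2. Finite combinations of Hermite functions on various rays
    ([wick_polynomial]) provide it for polynomials, the full Hermite series for exponentials.
    Continuity is invoked only at an exponential, where the tail of the series is again a series on
    the same ray and falls under the same estimate. The variance is an artefact of the
    decomposition: it enters as a factor [exp(- a t^2)] and cancels on the way back from Hermite
    functions to powers, so the moments depend only on the quadratic form in the T-transform. *)

(** * Sums over subsets and over block partitions *)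

(** The sum factors over the points of [T]: a point of [U] must lie in [S] and contributes 1, any
    other point contributes [1 - 1]. *)
Lemma sum_sign_supersets (C : comNzRingType) (T : finType) (U : {set T}) :
  \sum_(S : {set T}) (-1) ^+ #|~: S| * (U \subset S)%:R
  = (U == [set: T])%:R :> C.
Proof.
transitivity (\prod_(i : T) (1 + (if i \in U then 0 else -1)) : C).
  rewrite bigA_distr; apply: eq_bigr => S _.
  have [US|] := boolP (U \subset S); last first.
    rewrite mulr0 => /fintype.subsetPn[x xU xS].
    by rewrite (bigD1 x)//= (negPf xS) xU mul0r.
  rewrite mulr1 (bigID (mem S))/= [X in X * _]big1 ?mul1r; last by move=> i ->.
  rewrite (eq_bigr (fun=> -1)) => [|i /negPf iS].
    by rewrite prodr_const; congr (_ ^+ _); apply: eq_card => i; rewrite !inE.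
  by rewrite iS; case: ifP => // /(fintype.subsetP US); rewrite iS.
have [->|] := eqVneq U [set: T].
  by rewrite big1// => i _; rewrite inE addr0.
rewrite -finset.subTset => /fintype.subsetPn[x _ xU].
by rewrite (bigD1 x)//= (negPf xU) subrr mul0r.
Qed.

(** For [r = 2] these are the perfect pairings; [r = 1], where only the partition into singletons
    remains, gives polarization. *)
Definition block_partition (T : finType) (r : nat) (P : {set {set T}}) : bool :=
  finset.partition P [set: T] && [forall B in P, #|B| == r].

Lemma block_partition_card (T : finType) (r m : nat) (P : {set {set T}}) :
  (0 < r)%N -> #|T| = (m * r)%N -> block_partition r P -> #|P| = m.
Proof.
move=> r0 cT /andP[/card_partition cP /forall_inP Pr]; apply/eqP.
rewrite -(eqn_pmul2r r0) -cT -cardsT cP (eq_bigr (fun=> r)) ?sum_nat_const//.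
by move=> B /Pr/eqP.
Qed.

Lemma leq_card_bigcup (T I : finType) (f : I -> {set T}) :
  (#|\bigcup_i f i| <= \sum_i #|f i|)%N.
Proof.
apply: (big_rec2 (fun (x : {set T}) y => #|x| <= y)%N) => [|i y x _ le].
  by rewrite cards0.
by rewrite (leq_trans _ (leq_add (leqnn _) le))// cardsU leq_subr.
Qed.

(** Counting leaves no slack: [m] sets of at most [r] points can cover [m * r] points only if all
    have exactly [r] points and no two meet. *)
Lemma cover_tight (T : finType) (r m : nat) (f : {ffun 'I_m -> {set T}}) :
  (0 < r)%N -> #|T| = (m * r)%N -> (forall a, #|f a| <= r)%N ->
  \bigcup_a f a = [set: T] ->
  injectiveb f && block_partition r [set f a | a : 'I_m].
Proof.
move=> r0 cT fr fT.
have sumr : (\sum_(a < m) r)%N = #|T| by rewrite sum_nat_const card_ord cT.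
have le1 : (#|T| <= \sum_a #|f a|)%N by rewrite -cardsT -fT leq_card_bigcup.
have fE a : #|f a| = r.
  apply/eqP; rewrite eqn_leq fr/= leqNgt; apply/negP => lt.
  move: le1; rewrite leqNgt -sumr (bigD1 a)//= [X in (_ < X)%N](bigD1 a)//=.
  by rewrite -addSn leq_add// leq_sum.
have disj a b : a != b -> f a :&: f b = finset.set0.
  move=> ab; apply/eqP; rewrite -cards_eq0.
  (* Counting [f a] and [f b] through their union leaves [m - 2] further blocks, so the union must
     have [2 r] points. *)
  have : (#|T| <= #|f a :|: f b| + \sum_(i | (i != a) && (i != b)) #|f i|)%N.
    rewrite -cardsT -fT (bigD1 a)//= (bigD1 b) 1?eq_sym//= finset.setUA.
    rewrite (leq_trans (leq_card_setU _ _))// leq_add2l.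
    apply: (big_rec2 (fun (x : {set T}) y => #|x| <= y)%N) => [|i y x _ le].
      by rewrite cards0.
    by rewrite (leq_trans (leq_card_setU _ _))// leq_add2l.
  rewrite -sumr (bigD1 a)//= (bigD1 b) 1?eq_sym//= addnA.
  rewrite [X in (_ <= _ + X -> _)%N](eq_bigr (fun=> r)) => [|i _]; last exact: fE.
  rewrite leq_add2r cardsU !fE => le.
  by have := subset_leq_card (finset.subsetIl (f a) (f b)); rewrite fE; lia.
have finj : injective f.
  move=> a b fab; apply/eqP/negPn/negP => /disj.
  by rewrite fab finset.setIid => /(congr1 (fun x : {set T} => #|x|));
      rewrite fE cards0 => r_0; rewrite r_0 in r0.
apply/andP; split; first exact/injectiveP.
apply/andP; split; last first.
  by apply/forall_inP => B /imsetP[a _ ->]; rewrite fE.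
apply/and3P; split.
- by rewrite cover_imset fT.
- apply/finset.trivIsetP => _ _ /imsetP[a _ ->] /imsetP[b _ ->] ab.
  by rewrite -finset.setI_eq0 disj//; apply: contra ab => /eqP->.
- by apply/imsetP => -[a _ /(congr1 (fun x : {set T} => #|x|))];
    rewrite fE cards0 => r_0; rewrite -r_0 in r0.
Qed.

(** The power expands over [m]-tuples of subsets, and the signed sum over [S] keeps the tuples that
    cover [T]. As [c] vanishes on large blocks, these are the ordered partitions into blocks of size
    [r], whence the factor [m!]. Smaller blocks may have nonzero [c]; this absorbs the diagonal
    terms of a quadratic form. *)
Lemma sum_sign_power (C : comNzRingType) (T : finType) (r m : nat)
    (c : {set T} -> C) :
  (0 < r)%N -> #|T| = (m * r)%N -> (forall B : {set T}, (r < #|B|)%N -> c B = 0) ->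
  \sum_(S : {set T}) (-1) ^+ #|~: S| * (\sum_(B : {set T} | B \subset S) c B) ^+ m
  = m`!%:R * \sum_(P : {set {set T}} | block_partition r P) \prod_(B in P) c B.
Proof.
move=> r0 cT c0.
have expand (S : {set T}) : (\sum_(B : {set T} | B \subset S) c B) ^+ m =
    \sum_(f : {ffun 'I_m -> {set T}})
      (\bigcup_a f a \subset S)%:R * \prod_a c (f a).
  have -> (y : C) : y ^+ m = \prod_(a < m) y by rewrite prodr_const card_ord.
  under eq_bigr do rewrite big_mkcond.
  rewrite bigA_distr_bigA/=.
  apply: eq_bigr => f _; have [fS|] := boolP (_ \subset _).
    by rewrite mul1r; apply: eq_bigr => a _; rewrite (finset.bigcupsP fS).
  rewrite mul0r => /finset.bigcupsP fS.
  have [a aS] : exists a, ~~ (f a \subset S).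
    by apply/existsP; rewrite -negb_forall; apply/negP => /forallP h; apply: fS.
  by rewrite (bigD1 a)//= (negPf aS) mul0r.
under eq_bigr do rewrite expand mulr_sumr.
rewrite exchange_big/=.
under eq_bigr => f _ do under eq_bigr do rewrite mulrA.
under eq_bigr do rewrite -mulr_suml sum_sign_supersets.
pose good (f : {ffun 'I_m -> {set T}}) :=
  injectiveb f && block_partition r [set f a | a : 'I_m].
transitivity (\sum_(f | good f) \prod_a c (f a)).
  rewrite [RHS]big_mkcond; apply: eq_bigr => f _.
  case: ifP => [/andP[_ /andP[/cover_partition + _]]|].
    by rewrite cover_imset => ->; rewrite eqxx mul1r.
  move=> ngood; have [fT|] := eqVneq (\bigcup_a f a) [set: T]; last by rewrite mul0r.
  rewrite mul1r; have [/forallP fr|] := boolP [forall a, #|f a| <= r]%N.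
    by move: (cover_tight r0 cT fr fT); rewrite -/(good f) ngood.
  rewrite negb_forall => /existsP[a]; rewrite -ltnNge => /c0 ca.
  by rewrite (bigD1 a)//= ca mul0r.
rewrite (partition_big (fun f : {ffun 'I_m -> {set T}} => [set f a | a : 'I_m])
  (block_partition r)) /=; last by move=> f /andP[].
rewrite mulr_sumr; apply: eq_bigr => P PP.
have cP := block_partition_card r0 cT PP.
(* The tuples with block set [P] are the injections into [P]: since [P] has [m] elements,
   injectivity makes them onto. *)
transitivity (\sum_(f : {ffun 'I_m -> {set T}} | (f \in ffun_on P) && injectiveb f)
   \prod_(B in P) c B).
  apply: eq_big => [f|f /andP[/andP[/injectiveP finj _] /eqP <-]].
    apply/andP/andP => [[/andP[fi _] /eqP <-]|[/ffun_onP fP fi]].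
      by split=> //; apply/ffun_onP => a; apply: imset_f.
    suff fE : [set f a | a : 'I_m] = P by rewrite /good fi fE.
    apply/eqP; rewrite eqEcard; apply/andP; split.
      by apply/fintype.subsetP => _ /imsetP[a _ ->].
    by rewrite cP card_imset ?card_ord//; apply/injectiveP.
  by rewrite big_imset//= => a b _ _ /finj.
rewrite sumr_const -[LHS]mulr_natl; congr (_%:R * _).
have := card_inj_ffuns_on 'I_m (mem P).
rewrite [X in _ = X ^_ _]cP [X in _ = _ ^_ X]card_ord ffactnn => <-.
by apply: eq_card => f; rewrite !inE.
Qed.

(** The case [r = 1] of [sum_sign_power], with [c] carried by singletons. *)
Lemma prod_polarization (C : comNzRingType) (T : finType) (x : T -> C) :
  \sum_(S : {set T}) (-1) ^+ #|~: S| * (\sum_(k in S) x k) ^+ #|T|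
  = (#|T|)`!%:R * \prod_k x k.
Proof.
pose c (B : {set T}) : C := if #|B| == 1%N then \prod_(k in B) x k else 0.
have c1 k : c [set k] = x k by rewrite /c cards1 eqxx big_set1.
transitivity (\sum_(S : {set T}) (-1) ^+ #|~: S| *
    (\sum_(B : {set T} | B \subset S) c B) ^+ #|T|).
  apply: eq_bigr => S _; congr (_ * _ ^+ _); apply/esym.
  rewrite (bigID (fun B : {set T} => B \in [set [set k] | k in S]))/= [X in _ + X]big1
      ?addr0 => [|B].
    rewrite (eq_bigl (mem [set [set k] | k in S])) => [|B]; last first.
      rewrite /= andb_idl// => /imsetP[k kS ->]; by rewrite finset.sub1set.
    by rewrite big_imset/= => [|k l _ _ /finset.set1_inj//]; apply: eq_bigr => k _;
        rewrite c1.
  case/andP=> BS; rewrite /c; case: ifP => // /cards1P[k Bk] /imsetP[].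
  by exists k => //; move: BS; rewrite Bk finset.sub1set.
rewrite (@sum_sign_power _ _ 1)//; [|by rewrite muln1|]; last first.
  by move=> B; rewrite /c; case: eqP => // ->.
congr (_ * _); rewrite (big_pred1 [set [set k] | k : T]) => [|P /=].
  by rewrite big_imset/= => [|k l _ _ /finset.set1_inj//]; apply: eq_bigr => k _.
have bT : block_partition 1 [set [set k] | k : T].
  apply/andP; split; last by apply/forall_inP => B /imsetP[k _ ->]; rewrite cards1.
  apply/and3P; split.
  - by rewrite cover_imset; apply/eqP/finset.setP => k; rewrite inE;
      apply/finset.bigcupP; exists k; rewrite ?inE.
  - apply/finset.trivIsetP => _ _ /imsetP[a _ ->] /imsetP[b _ ->] ab.
    by rewrite disjoints1 inE; apply: contra ab => /eqP->.
  - by apply/imsetP => -[k _ /esym/eqP]; rewrite -cards_eq0 cards1.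
apply/idP/eqP => [bP|-> //].
apply/eqP; rewrite eqEcard (@block_partition_card _ 1 #|T| _ _ _ bT) ?muln1//.
rewrite (@block_partition_card _ 1 #|T| _ _ _ bP) ?muln1// leqnn andbT.
apply/fintype.subsetP => B BP; case/andP: bP => _ /forall_inP/(_ _ BP)/cards1P[k ->].
exact: imset_f.
Qed.

Local Open Scope classical_set_scope.
Local Open Scope complex_scope.
Local Open Scope ring_scope.

(** * Complex convergence and Cauchy products *)

Section complex_modulus.
Variable R : realType.
Implicit Types (x y z : R[i]) (u v : nat -> R[i]).

Lemma normc_ge0 z : 0 <= normc z.
Proof. by case: z => a b; exact: sqrtr_ge0. Qed.

Lemma ler_normcD x y : normc (x + y) <= normc x + normc y.
Proof. exact: (@le_normcD R x y). Qed.

Lemma normcN z : normc (- z) = normc z.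
Proof. exact: (@complex.normcN R z). Qed.

Lemma normcB x y : normc (x - y) = normc (y - x).
Proof. by rewrite -normcN opprB. Qed.

Lemma normcX z n : normc (z ^+ n) = normc z ^+ n.
Proof.
by elim: n => [|n IH]; rewrite ?expr0 ?normc1// !exprS normcM IH.
Qed.

Lemma normc_real (r : R) : normc r%:C = `|r|.
Proof. by rewrite /= expr0n /= addr0 sqrtr_sqr. Qed.

Lemma normc_nat n : normc (n%:R : R[i]) = n%:R.
Proof.
have -> : (n%:R : R[i]) = (n%:R : R)%:C by rewrite raddfMn.
by rewrite normc_real ger0_norm.
Qed.

Lemma ler_normc_sum (I : Type) (r : seq I) (P : pred I) (F : I -> R[i]) :
  normc (\sum_(i <- r | P i) F i) <= \sum_(i <- r | P i) normc (F i).
Proof.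
apply: (big_rec2 (fun x (y : R) => normc x <= y)) => [|i y x _ le].
  by rewrite normc0.
by rewrite (le_trans (ler_normcD _ _))// lerD2l.
Qed.

Lemma Re_sum (I : Type) (r : seq I) (P : pred I) (F : I -> R[i]) :
  complex.Re (\sum_(i <- r | P i) F i) = \sum_(i <- r | P i) complex.Re (F i).
Proof. exact: (raddf_sum (@complex.Re R : Rcomplex R -> R)). Qed.

Lemma Im_sum (I : Type) (r : seq I) (P : pred I) (F : I -> R[i]) :
  complex.Im (\sum_(i <- r | P i) F i) = \sum_(i <- r | P i) complex.Im (F i).
Proof. exact: (raddf_sum (@complex.Im R : Rcomplex R -> R)). Qed.

Lemma normcE2 z : normc z ^+ 2 = complex.Re z ^+ 2 + complex.Im z ^+ 2.
Proof. by case: z => a b; rewrite sqr_sqrtr// addr_ge0// sqr_ge0. Qed.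

Lemma normRe_le z : `|complex.Re z| <= normc z.
Proof.
by rewrite -ler_sqr ?nnegrE ?normc_ge0// normcE2 real_normK ?num_real// lerDl sqr_ge0.
Qed.

Lemma normIm_le z : `|complex.Im z| <= normc z.
Proof.
by rewrite -ler_sqr ?nnegrE ?normc_ge0// normcE2 real_normK ?num_real// lerDr sqr_ge0.
Qed.

Lemma normc_leD z : normc z <= `|complex.Re z| + `|complex.Im z|.
Proof.
rewrite -ler_sqr ?nnegrE ?normc_ge0 ?addr_ge0// normcE2 sqrrD.
by rewrite !real_normK ?num_real// addrAC lerDl mulrn_wge0// mulr_ge0.
Qed.

Lemma Re_add x y : complex.Re (x + y) = complex.Re x + complex.Re y.
Proof. by case: x y => ? ? []. Qed.

Lemma Im_add x y : complex.Im (x + y) = complex.Im x + complex.Im y.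
Proof. by case: x y => ? ? []. Qed.

Lemma Re_sub x y : complex.Re (x - y) = complex.Re x - complex.Re y.
Proof. by case: x y => ? ? []. Qed.

Lemma Im_sub x y : complex.Im (x - y) = complex.Im x - complex.Im y.
Proof. by case: x y => ? ? []. Qed.

Lemma Re_mul x y : complex.Re (x * y) =
  complex.Re x * complex.Re y - complex.Im x * complex.Im y.
Proof. by case: x y => ? ? []. Qed.

Lemma Im_mul x y : complex.Im (x * y) =
  complex.Re x * complex.Im y + complex.Im x * complex.Re y.
Proof. by case: x y => ? ? []. Qed.

Lemma complex_eq x y :
  complex.Re x = complex.Re y -> complex.Im x = complex.Im y -> x = y.
Proof. by case: x y => a b [c d]/= -> ->. Qed.

Lemma ccvgP u l : ccvg u l <->
  (@complex.Re R \o u @ \oo --> complex.Re l) /\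
  (@complex.Im R \o u @ \oo --> complex.Im l).
Proof.
split=> [ul|[re im]].
  split; apply/cvgrPdist_lt => e e0; move/cvgr0Pnorm_lt : ul => /(_ e e0);
    apply: filterS => n; rewrite ger0_norm ?normc_ge0// normcB => lt;
    rewrite (le_lt_trans _ lt)//.
  - by rewrite -Re_sub normRe_le.
  - by rewrite -Im_sub normIm_le.
apply: (@squeeze_cvgr _ _ _ _ (fun=> 0)
    (fun n => `|complex.Re (u n) - complex.Re l| + `|complex.Im (u n) - complex.Im l|)).
- near=> n; rewrite normc_ge0/= (le_trans (normc_leD _))//.
  by rewrite Re_sub Im_sub.
- exact: cvg_cst.
- rewrite -[X in _ --> X](addr0 0); apply: cvgD.
    by apply/norm_cvg0P; apply/subr_cvg0.
  by apply/norm_cvg0P; apply/subr_cvg0.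
Unshelve. all: by end_near. Qed.

Lemma ccvg_cst (l : R[i]) : ccvg (R := R) (fun=> l) l.
Proof. by apply/ccvgP; split; exact: cvg_cst. Qed.

Lemma ccvgM u v l m : ccvg u l -> ccvg v m -> ccvg (fun n => u n * v n) (l * m).
Proof.
move=> /ccvgP[ru iu] /ccvgP[rv iv]; apply/ccvgP; split.
  rewrite Re_mul (_ : _ \o _ = fun n => complex.Re (u n) * complex.Re (v n)
    - complex.Im (u n) * complex.Im (v n)); last by apply/funext => n;
        rewrite /= Re_mul.
  by apply: cvgB; apply: cvgM.
rewrite Im_mul (_ : _ \o _ = fun n => complex.Re (u n) * complex.Im (v n)
  + complex.Im (u n) * complex.Re (v n)); last by apply/funext => n; rewrite /= Im_mul.
by apply: cvgD; apply: cvgM.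
Qed.

Lemma ccvg_sub0 u v l : ccvg v l -> ccvg (fun n => u n - v n) 0 -> ccvg u l.
Proof.
move=> /ccvgP[rv iv] /ccvgP[rd id]; apply/ccvgP; split.
  rewrite -[complex.Re l]add0r (_ : _ \o u = (@complex.Re R \o (fun n => u n - v n)) \+
      (@complex.Re R \o v)).
    exact: cvgD.
  by apply/funext => n /=; rewrite -Re_add subrK.
rewrite -[complex.Im l]add0r (_ : _ \o u = (@complex.Im R \o (fun n => u n - v n)) \+
    (@complex.Im R \o v)).
  exact: cvgD.
by apply/funext => n /=; rewrite -Im_add subrK.
Qed.

End complex_modulus.

Section cauchy_product.

Definition conv (K : pzSemiRingType) (f g : nat -> K) (n : nat) : K :=
  \sum_(i < n.+1) f i * g (n - i)%N.

Lemma sum_conv (K : pzSemiRingType) (f g : nat -> K) (N : nat) :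
  \sum_(n < N) conv f g n = \sum_(i < N) f i * \sum_(j < N - i) g j.
Proof.
elim: N => [|N IH]; first by rewrite !big_ord0.
rewrite big_ord_recr/= IH /conv !big_ord_recr/= subnn subSnn big_ord1 addrA.
rewrite -big_split/=; congr (_ + _); apply: eq_bigr => i _.
by rewrite -mulrDr subSn ?big_ord_recr//= ltnW.
Qed.

Lemma conv_ge0 (K : numDomainType) (f g : nat -> K) n :
  (forall i, 0 <= f i) -> (forall i, 0 <= g i) -> 0 <= conv f g n.
Proof. by move=> f0 g0; apply: sumr_ge0 => i _; exact: mulr_ge0. Qed.

Lemma sum_conv_le (K : numDomainType) (f g : nat -> K) (N : nat) :
  (forall i, 0 <= f i) -> (forall i, 0 <= g i) ->
  \sum_(n < N) conv f g n <= (\sum_(i < N) f i) * \sum_(j < N) g j.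
Proof.
move=> f0 g0; rewrite sum_conv mulr_suml; apply: ler_sum => i _.
rewrite ler_wpM2l//= -!(big_mkord xpredT) [leRHS](@big_cat_nat _ _ _ (N - i)%N)//=
    ?leq_subr//.
by rewrite lerDl sumr_ge0.
Qed.

(** The sums of [conv] run over triangles [i + j < N]. Together with [sum_conv_le]: the square of
    side [N] contains the triangle of size [N] and is contained in that of size [2 N]. *)
Lemma sum_conv_ge (K : numDomainType) (f g : nat -> K) (N : nat) :
  (forall i, 0 <= f i) -> (forall i, 0 <= g i) ->
  (\sum_(i < N) f i) * (\sum_(j < N) g j) <= \sum_(n < N + N) conv f g n.
Proof.
move=> f0 g0; rewrite sum_conv big_split_ord/= mulr_suml.
rewrite -[leLHS]addr0 lerD//; last first.
  by apply: sumr_ge0 => i _; rewrite mulr_ge0// sumr_ge0.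
apply: ler_sum => i _; rewrite ler_wpM2l//= -!(big_mkord xpredT).
rewrite [leRHS](@big_cat_nat _ _ _ N)//=; last by rewrite -addnBA ?leq_addr// ltnW.
by rewrite lerDl sumr_ge0.
Qed.

Variable R : realType.

Lemma nondecreasing_sum (h : nat -> R) : (forall i, 0 <= h i) ->
  nondecreasing_seq (fun N => \sum_(i < N) h i).
Proof.
by move=> h0; apply/nondecreasing_seqP => n; rewrite big_ord_recr/= lerDl.
Qed.

Lemma sum_le_lim (h : nat -> R) (l : R) N : (forall i, 0 <= h i) ->
  (fun N => \sum_(i < N) h i) @ \oo --> l -> \sum_(i < N) h i <= l.
Proof.
move=> h0 hl; rewrite -(cvg_lim _ hl)//.
apply: nondecreasing_cvgn_le; first exact: nondecreasing_sum.
by apply/cvg_ex; exists l.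
Qed.

Lemma cvg_sum_conv (f g : nat -> R) (A B : R) :
  (forall i, 0 <= f i) -> (forall i, 0 <= g i) ->
  (fun N => \sum_(i < N) f i) @ \oo --> A ->
  (fun N => \sum_(i < N) g i) @ \oo --> B ->
  (fun N => \sum_(n < N) conv f g n) @ \oo --> A * B.
Proof.
move=> f0 g0 fA gB.
have fAB : (fun N => (\sum_(i < N) f i) * \sum_(i < N) g i) @ \oo --> A * B.
  exact: cvgM.
have ubd N : \sum_(n < N) conv f g n <= A * B.
  rewrite (le_trans (sum_conv_le _ _ _))// ler_pM//; first exact: sumr_ge0.
  - exact: sumr_ge0.
  - exact: sum_le_lim.
  - exact: sum_le_lim.
have cc : cvgn (fun N => \sum_(n < N) conv f g n).
  apply: nondecreasing_is_cvgn; first by apply: nondecreasing_sum => i; exact: conv_ge0.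
  by exists (A * B) => _ [N _ <-].
suff -> : A * B = limn (fun N => \sum_(n < N) conv f g n) by [].
apply/eqP; rewrite eq_le; apply/andP; split.
  rewrite -(cvg_lim _ fAB)//; apply: limr_le; first by apply/cvg_ex; exists (A * B).
  near=> N; rewrite (le_trans (sum_conv_ge _ _ _))//.
  by apply: (nondecreasing_cvgn_le _ cc); apply: nondecreasing_sum => i;
      exact: conv_ge0.
by apply: limr_le => //; near=> N.
Unshelve. all: by end_near. Qed.

Lemma normc_conv_le (f g : nat -> R[i]) n :
  normc (conv f g n) <= conv (@normc R \o f) (@normc R \o g) n.
Proof.
by rewrite (le_trans (ler_normc_sum _ _ _))//; apply: ler_sum => i _; rewrite normcM.
Qed.

(** Square minus triangle is a sum of terms [f i * g j]; it is dominated by the same difference for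
    the moduli, which tends to 0 by the nonnegative case. *)
Lemma ccvg_sum_conv (f g : nat -> R[i]) (A B : R[i]) (a b : R) :
  (fun N => \sum_(i < N) normc (f i)) @ \oo --> a ->
  (fun N => \sum_(i < N) normc (g i)) @ \oo --> b ->
  ccvg (fun N => \sum_(i < N) f i) A ->
  ccvg (fun N => \sum_(i < N) g i) B ->
  ccvg (fun N => \sum_(n < N) conv f g n) (A * B).
Proof.
move=> fa gb fA gB; apply: (ccvg_sub0 (ccvgM fA gB)).
have f0 i : 0 <= (@normc R \o f) i by exact: normc_ge0.
have g0 i : 0 <= (@normc R \o g) i by exact: normc_ge0.
have cab := cvg_sum_conv f0 g0 fa gb.
have fab : (fun N => (\sum_(i < N) normc (f i)) * \sum_(i < N) normc (g i)) @ \oo --> a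
    * b.
  exact: cvgM.
apply: (@squeeze_cvgr _ _ _ _ (fun=> 0) (fun N => (\sum_(i < N) normc (f i)) * (\sum_(i
    < N) normc (g i))
   - \sum_(n < N) conv (@normc R \o f) (@normc R \o g) n)); last 2 first.
- exact: cvg_cst.
- rewrite -[X in _ --> X](subrr (a * b)); apply: cvgB; [exact: fab|exact: cab].
near=> N; rewrite normc_ge0/= subr0 normcB.
rewrite !sum_conv !mulr_suml -!sumrB (le_trans (ler_normc_sum _ _ _))//.
apply: ler_sum => i _; rewrite -!mulrBr normcM ler_wpM2l ?normc_ge0//=.
have -> : \sum_(j < N) g j = \sum_(j < N - i) g j + \sum_(N - i <= j < N) g j.
  by rewrite -!(big_mkord xpredT) -big_cat_nat//= leq_subr.
have -> : \sum_(j < N) normc (g j) =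
    \sum_(j < N - i) normc (g j) + \sum_(N - i <= j < N) normc (g j).
  by rewrite -!(big_mkord xpredT (fun j => normc (g j))) -big_cat_nat//= leq_subr.
by rewrite addrAC subrr add0r [leRHS]addrAC subrr add0r ler_normc_sum.
Unshelve. all: by end_near. Qed.

End cauchy_product.

(** * Exponential and Hermite series *)

Section exponential_series.
Variable R : realType.
Implicit Types (x y z w : R[i]) (s t : R).

Definition cexp_coeff z (n : nat) : R[i] := z ^+ n / n`!%:R.

Lemma normc_cexp_coeff z n : normc (cexp_coeff z n) = normc z ^+ n / n`!%:R.
Proof. by rewrite /cexp_coeff normcM normcV normcX normc_nat. Qed.

Lemma cvg_expR_sum s : (fun N => \sum_(n < N) s ^+ n / n`!%:R) @ \oo --> expR s.
Proof.
have /cvg_ex[l sl] := is_cvg_series_exp_coeff s.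
rewrite /expR (cvg_lim _ sl)//; move: sl.
apply: cvg_trans; apply: near_eq_cvg; near=> n.
by rewrite /series/= big_mkord.
Unshelve. all: by end_near.
Qed.

Lemma sum_expR_le s N : 0 <= s -> \sum_(n < N) s ^+ n / n`!%:R <= expR s.
Proof.
move=> s0; apply: (@sum_le_lim _ (fun n => s ^+ n / n`!%:R)); last exact: cvg_expR_sum.
by move=> i; rewrite divr_ge0// exprn_ge0.
Qed.

Lemma cvg_normc_cexp_coeff z :
  (fun N => \sum_(n < N) normc (cexp_coeff z n)) @ \oo --> expR (normc z).
Proof.
under eq_fun do under eq_bigr do rewrite normc_cexp_coeff.
exact: cvg_expR_sum.
Qed.

Lemma conv_cexp_coeff x y n :
  conv (cexp_coeff x) (cexp_coeff y) n = cexp_coeff (x + y) n.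
Proof.
rewrite /cexp_coeff addrC exprDn mulr_suml; apply: eq_bigr => i _.
have ni : (i <= n)%N by rewrite -ltnS.
have bin0 : (('C(n, i) * (i`! * (n - i)`!))%N%:R : R[i]) = n`!%:R by rewrite bin_fact.
have f0 k : (k`!%:R : R[i]) != 0 by rewrite pnatr_eq0 -lt0n fact_gt0.
rewrite -bin0 !natrM -mulr_natr.
have C0 : ('C(n, i)%:R : R[i]) != 0 by rewrite pnatr_eq0 -lt0n bin_gt0.
by field; rewrite C0 !f0.
Qed.

Lemma ccvg_cexp_real s : ccvg (fun N => \sum_(n < N) cexp_coeff s%:C n) (expR s)%:C.
Proof.
have E n : cexp_coeff s%:C n = (s ^+ n / n`!%:R)%:C.
  rewrite /cexp_coeff rmorphM/= rmorphXn/= fmorphV/=; congr (_ / _).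
  by rewrite raddfMn.
apply/ccvgP; split; rewrite /=.
  have := @cvg_expR_sum s; apply: cvg_trans; apply: near_eq_cvg; near=> N.
  by rewrite /= Re_sum; apply: eq_bigr => n _; rewrite E.
apply: cvg_near_cst; near=> N.
by rewrite /= Im_sum big1// => n _; rewrite E.
Unshelve. all: by end_near. Qed.

Lemma cexp_coeff_imag t n :
  cexp_coeff ('i%C * t%:C) n = (cos_coeff t n +i* sin_coeff t n)%C.
Proof.
have E : cexp_coeff ('i%C * t%:C) n = 'i%C ^+ n * (t ^+ n / n`!%:R)%:C.
  rewrite /cexp_coeff exprMn -mulrA; congr (_ * _).
  rewrite rmorphM/= rmorphXn/= fmorphV/=; congr (_ / _).
  by rewrite raddfMn.
(* The right-hand side follows the form of [cos_coeff] and [sin_coeff]. The exponent [n.-1./2]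
   differs from [n./2] only for positive even [n], where the factor [odd n] is 0. *)
have iE : ('i%C ^+ n : R[i]) =
    ((~~ odd n)%:R * (-1) ^+ n./2 +i* ((odd n)%:R * (-1) ^+ n.-1./2))%C.
  rewrite -{1}(odd_double_half n) exprD -mul2n exprM sqr_i.
  have -> : n.-1./2 = (n./2 - ~~ odd n)%N.
    by case: {E} n => // n /=; rewrite uphalf_half; case: (odd n);
        rewrite /= ?subn0 ?add1n ?subn1 ?add0n.
  have -> : ((-1) ^+ n./2 : R[i]) = ((-1) ^+ n./2)%:C by rewrite rmorphXn rmorphN1.
  case: (odd n) => /=; rewrite ?expr1 ?expr0 ?subn0.
    by rewrite !mul0r !mul1r; apply: complex_eq;
        rewrite /= ?mul0r ?mul1r ?mulr0 ?subr0 ?addr0 ?add0r.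
  by rewrite !mul0r !mul1r.
by rewrite E iE; apply: complex_eq; rewrite /= mulr0 ?subr0 ?add0r mulrA.
Qed.

Lemma ccvg_cexp_imag t :
  ccvg (fun N => \sum_(n < N) cexp_coeff ('i%C * t%:C) n) (cos t +i* sin t)%C.
Proof.
apply/ccvgP; split => /=.
  have /cvg_ex[l cl] := @is_cvg_series_cos_coeff R t.
  rewrite cos.unlock (cvg_lim _ cl)//; apply: cvg_trans cl.
  apply: near_eq_cvg; near=> N; rewrite /series/= big_mkord Re_sum.
  by apply: eq_bigr => n _; rewrite cexp_coeff_imag.
have /cvg_ex[l cl] := @is_cvg_series_sin_coeff R t.
rewrite sin.unlock (cvg_lim _ cl)//; apply: cvg_trans cl.
apply: near_eq_cvg; near=> N; rewrite /series/= big_mkord Im_sum.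
by apply: eq_bigr => n _; rewrite cexp_coeff_imag.
Unshelve. all: by end_near. Qed.

(** [cexp] is built from [expR], [cos] and [sin]; its power series is the Cauchy product of those of
    the real and the imaginary exponential. *)
Lemma ccvg_cexp z : ccvg (fun N => \sum_(n < N) cexp_coeff z n) (cexp z).
Proof.
have -> : cexp z = (expR (complex.Re z))%:C * (cos (complex.Im z) +i* sin (complex.Im
    z))%C.
  by apply: complex_eq; rewrite /= !mul0r ?subr0 ?addr0.
have zE : z = (complex.Re z)%:C + 'i%C * (complex.Im z)%:C by exact: complexE.
have -> : (fun N => \sum_(n < N) cexp_coeff z n) = (fun N => \sum_(n < N)
    conv (cexp_coeff (complex.Re z)%:C) (cexp_coeff ('i%C * (complex.Im z)%:C)) n).
  by apply/funext => N; apply: eq_bigr => n _; rewrite conv_cexp_coeff -zE.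
apply: ccvg_sum_conv.
- exact: cvg_normc_cexp_coeff.
- exact: cvg_normc_cexp_coeff.
- exact: ccvg_cexp_real.
- exact: ccvg_cexp_imag.
Qed.

Lemma cexpD x y : cexp (x + y) = cexp x * cexp y.
Proof.
case: x y => a b [c d]; apply: complex_eq; rewrite /= expRD ?cosD ?sinD; ring.
Qed.

Lemma cexp0 : cexp (0 : R[i]) = 1.
Proof. by apply: complex_eq; rewrite /= expR0 ?cos0 ?sin0 ?mulr1 ?mulr0. Qed.

Lemma cexpNM z : cexp (- z) * cexp z = 1.
Proof. by rewrite -cexpD addNr cexp0. Qed.

(* Coefficients in [t] of [exp (w t ^ 2)]. *)
Definition gauss_coeff w (n : nat) : R[i] :=
  if odd n then 0 else cexp_coeff w n./2.

Lemma gauss_coeffZ w z n : gauss_coeff w n * z ^+ n = gauss_coeff (w * z ^+ 2) n.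
Proof.
rewrite /gauss_coeff; case: ifP => nodd; first by rewrite mul0r.
rewrite /cexp_coeff exprMn -exprM mul2n -[in LHS](odd_double_half n) nodd add0n doubleK.
by rewrite mulrAC.
Qed.

Lemma normc_gauss_coeff w n :
  normc (gauss_coeff w n) = if odd n then 0 else normc w ^+ n./2 / n./2`!%:R.
Proof. by rewrite /gauss_coeff; case: ifP; rewrite ?normc0// normc_cexp_coeff. Qed.

Lemma big_even (V : nmodType) (f : nat -> V) N :
  \sum_(n < N) (if odd n then 0 else f n./2) = \sum_(n < uphalf N) f n.
Proof.
elim: N => [|N IH]; first by rewrite !big_ord0.
rewrite big_ord_recr/= IH uphalf_half; case: (odd N); first by rewrite addr0.
by rewrite add0n big_ord_recr.
Qed.

Lemma cvg_uphalf (T : topologicalType) (u : nat -> T) (l : T) :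
  u @ \oo --> l -> (fun n => u (uphalf n)) @ \oo --> l.
Proof.
move=> ul; apply: cvg_comp ul; apply/cvgnyPge => A; exists A.*2 => // n /= An.
by rewrite geq_uphalf_double ltnW. Qed.

Lemma ccvg_gauss_coeff w : ccvg (fun N => \sum_(n < N) gauss_coeff w n) (cexp w).
Proof.
under eq_fun do rewrite big_even.
exact: (cvg_uphalf (ccvg_cexp w)).
Qed.

Lemma cvg_normc_gauss_coeff w :
  (fun N => \sum_(n < N) normc (gauss_coeff w n)) @ \oo --> expR (normc w).
Proof.
under eq_fun do under eq_bigr do rewrite normc_gauss_coeff.
under eq_fun do rewrite (big_even (fun n => normc w ^+ n / n`!%:R)).
exact: (@cvg_uphalf _ (fun N => \sum_(n < N) normc w ^+ n / n`!%:R) _ (@cvg_expR_sum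
    (normc w))).
Qed.

(** Coefficientwise form of [exp(w t^2) exp(z t^2) = exp((w + z) t^2)]: only even indices survive,
    and there it is [conv_cexp_coeff] at half the index. *)
Lemma conv_gauss_coeff w z n :
  conv (gauss_coeff w) (gauss_coeff z) n = gauss_coeff (w + z) n.
Proof.
rewrite /conv; have [nodd|neven] := boolP (odd n).
  have -> : gauss_coeff (w + z) n = 0 by rewrite /gauss_coeff nodd.
  apply: big1 => i _; have ni : (i <= n)%N by rewrite -ltnS.
  rewrite /gauss_coeff (oddB ni) nodd.
  by case: (odd i); rewrite /= ?mul0r ?mulr0.
rewrite [RHS]/gauss_coeff (negPf neven) -conv_cexp_coeff /conv.
have -> : n./2.+1 = uphalf n.+1 by [].
rewrite -(big_even (fun i => cexp_coeff w i * cexp_coeff z (n./2 - i))).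
apply: eq_bigr => i _; have ni : (i <= n)%N by rewrite -ltnS.
rewrite /gauss_coeff (oddB ni) (negPf neven)/=.
case: ifP => iodd; first by rewrite mul0r.
congr (_ * cexp_coeff _ _).
by move: ni iodd neven; case: i => i /= _; lia.
Qed.

Lemma gauss_coeff0 n : gauss_coeff 0 n = (n == 0%N)%:R.
Proof.
rewrite /gauss_coeff /cexp_coeff expr0n; case: n => [|[|n]]//=.
  by rewrite divr1.
by rewrite mul0r if_same.
Qed.

(** Up to index [n], convolutions are coefficients of products of truncating polynomials, and
    polynomial multiplication is associative. *)
Lemma convA (K : nzRingType) (f g h : nat -> K) n :
  conv (conv f g) h n = conv f (conv g h) n.
Proof.
pose P (f : nat -> K) := \poly_(i < n.+1) f i.
have PE (f1 g1 : nat -> K) (p q : {poly K}) : (forall k, (k <= n)%N -> p`_k = f1 k) ->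
    (forall k, (k <= n)%N -> q`_k = g1 k) ->
    forall k, (k <= n)%N -> (p * q)`_k = conv f1 g1 k.
  move=> pf qg k kn; rewrite coefM; apply: eq_bigr => i _.
  by rewrite pf ?qg//; [rewrite (leq_trans (leq_subr _ _))|rewrite (leq_trans _ kn)//
      -ltnS].
have P0 f1 k : (k <= n)%N -> (P f1)`_k = f1 k by move=> kn; rewrite coef_poly ltnS kn.
have Efg k : (k <= n)%N -> (P f * P g)`_k = conv f g k by apply: PE => j; exact: P0.
have Egh k : (k <= n)%N -> (P g * P h)`_k = conv g h k by apply: PE => j; exact: P0.
rewrite -(PE _ _ _ _ Efg (P0 h) n)// -mulrA.
exact: (PE _ _ _ _ (P0 f) Egh n).
Qed.

Lemma conv_delta (K : nzRingType) (f : nat -> K) n :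
  conv f (fun k => (k == 0%N)%:R) n = f n.
Proof.
rewrite /conv big_ord_recr/= subnn mulr1 big1 ?add0r// => i _.
by rewrite subn_eq0 leqNgt ltn_ord mulr0.
Qed.

Lemma eq_conv (K : nzRingType) (f f' g g' : nat -> K) n :
  (forall k, f k = f' k) -> (forall k, g k = g' k) -> conv f g n = conv f' g' n.
Proof. by move=> ff gg; apply: eq_bigr => i _; rewrite ff gg. Qed.

Lemma conv_scale (K : comNzRingType) (f g : nat -> K) (z : K) n :
  conv (fun k => f k * z ^+ k) (fun k => g k * z ^+ k) n = conv f g n * z ^+ n.
Proof.
rewrite /conv mulr_suml; apply: eq_bigr => i _.
by rewrite mulrACA -exprD subnKC// -ltnS.
Qed.

End exponential_series.

Section hermite.
Variable R : realType.
Implicit Types (a x z : R[i]) (s : R).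

(* [n`! * hermite a n x] is the [n]-th Hermite polynomial of variance [2 a]. *)
Definition hermite a (n : nat) x : R[i] :=
  conv (cexp_coeff x) (gauss_coeff (- a)) n.

Lemma hermite_scale a n x z :
  hermite a n x * z ^+ n = conv (cexp_coeff (z * x)) (gauss_coeff (- (a * z ^+ 2))) n.
Proof.
rewrite /hermite -conv_scale; apply: eq_conv => k.
  by rewrite /cexp_coeff exprMn [_ * x ^+ k]mulrC mulrAC.
by rewrite gauss_coeffZ mulNr.
Qed.

(** The generating function of the Hermite polynomials, as a Cauchy product of two absolutely
    convergent series. *)
Lemma ccvg_hermite a x z :
  ccvg (fun N => \sum_(n < N) hermite a n x * z ^+ n) (cexp (z * x - a * z ^+ 2)).
Proof.
rewrite cexpD; under eq_fun do under eq_bigr do rewrite hermite_scale.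
apply: ccvg_sum_conv.
- exact: cvg_normc_cexp_coeff.
- exact: cvg_normc_gauss_coeff.
- exact: ccvg_cexp.
- exact: ccvg_gauss_coeff.
Qed.

(** The bound does not depend on [N], so it can later serve as a dominating function. Passing to
    moduli turns [- a] into [|a|]. *)
Lemma sum_normc_hermite_le a x s N : 0 <= s ->
  \sum_(n < N) normc (hermite a n x) * s ^+ n
  <= expR (s * normc x + s ^+ 2 * normc a).
Proof.
move=> s0.
have E n : normc (hermite a n x) * s ^+ n <= conv (fun k => normc (cexp_coeff (s%:C *
    x) k))
    (fun k => normc (gauss_coeff (- (a * s%:C ^+ 2)) k)) n.
  have <- : normc (s%:C ^+ n) = s ^+ n by rewrite normcX normc_real ger0_norm.
  by rewrite -normcM hermite_scale; exact: normc_conv_le.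
apply: le_trans; first by apply: ler_sum => i _; exact: E.
rewrite (le_trans (sum_conv_le _ _ _))// => [i|i|]; try exact: normc_ge0.
have := @cvg_normc_cexp_coeff _ (s%:C * x); rewrite normcM normc_real ger0_norm// => h1.
have := @cvg_normc_gauss_coeff _ (- (a * s%:C ^+ 2)).
rewrite normcN normcM normcX normc_real ger0_norm// [normc a * _]mulrC => h2.
rewrite expRD ler_pM//.
- by apply: sumr_ge0 => i _; exact: normc_ge0.
- by apply: sumr_ge0 => i _; exact: normc_ge0.
- exact: (@sum_le_lim _ (fun n => normc (cexp_coeff (s%:C * x) n)) _ _ (fun i =>
    normc_ge0 _) h1).
- exact: (@sum_le_lim _ (fun n => normc (gauss_coeff (- (a * s%:C ^+ 2)) n)) _ _ (fun i
    => normc_ge0 _) h2).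
Qed.

(** Multiplying the generating function by [exp(a t^2)] gives back [exp(t x)]: this expresses
    monomials through Hermite polynomials. *)
Lemma hermite_inv a x n :
  conv (fun k => hermite a k x) (gauss_coeff a) n = cexp_coeff x n.
Proof.
rewrite -[LHS]/(conv (conv (cexp_coeff x) (gauss_coeff (- a))) (gauss_coeff a) n).
rewrite convA -[RHS]conv_delta; apply: eq_conv => // k.
by rewrite conv_gauss_coeff addNr gauss_coeff0.
Qed.

End hermite.

(** * Uniqueness of power series coefficients *)

Section power_series.
Variable R : realType.

(** Strong induction: once the lower coefficients vanish, dividing by [t^n] leaves [b n] plus a tail
    of size at most [2 t M], where convergence at [t = 1] supplies the bound [M] on the
    coefficients. *)
Lemma power_series0 (b : nat -> R) :
  (forall t, (fun N => \sum_(n < N) b n * t ^+ n) @ \oo --> 0) -> forall n, b n = 0.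
Proof.
move=> b0.
have [M [M0 bM]] : exists M : R, 0 <= M /\ forall n, `|b n| <= M.
  have cs : cvgn (series b).
    apply/cvg_ex; exists 0; apply: cvg_trans (b0 1); apply: near_eq_cvg; near=> N.
    by rewrite /series/= big_mkord; apply: eq_bigr => i _; rewrite expr1n mulr1.
  have [M [_ Mb]] := cvg_series_bounded cs.
  exists (Num.max 0 M + 1); split; first by rewrite addr_ge0// le_max lexx.
  by move=> n; apply: Mb => //;
      rewrite (@le_lt_trans _ _ (Num.max 0 M))// ?ltrDl// le_max lexx orbT.
elim/ltn_ind => n IH; apply/eqP; rewrite -normr_le0; apply/ler_addgt0Pl => e e0.
(* The bound [1/2] makes the geometric tail at most [2 t]; the second term makes [2 t M] at most
   [e / 2], with [M + 1] to divide by a positive number. *)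
pose t := Num.min 2^-1 (e / 2 / (M + 1) / 2).
have M1 : 0 < M + 1 by rewrite ltr_wpDl.
have t0 : 0 < t by rewrite lt_min invr_gt0 ltr0n/= !divr_gt0.
have t1 : t <= 2^-1 by rewrite ge_min lexx.
have tM : 2 * t * M <= e / 2.
  have : t <= e / 2 / (M + 1) / 2 by rewrite ge_min lexx orbT.
  rewrite ler_pdivlMr// ler_pdivlMr// => h; rewrite (le_trans _ h)// [2 * t]mulrC.
  by rewrite ler_wpM2l ?mulr_ge0 ?(ltW t0)// lerDl.
have tail N : `|\sum_(k < N) b (n.+1 + k)%N * t ^+ k.+1| <= 2 * t * M.
  have geo : forall N, \sum_(k < N) t ^+ k.+1 <= 2 * t.
    elim=> [|K IHK]; first by rewrite big_ord0 mulr_ge0 ?(ltW t0).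
    rewrite big_ord_recl/= expr1; under eq_bigr do rewrite /bump/= add1n exprS.
    rewrite -mulr_sumr mulrDl mul1r lerD2l ler_piMr ?(ltW t0)//.
    by rewrite (le_trans IHK)// -ler_pdivlMl// mulr1.
  rewrite (le_trans (ler_norm_sum _ _ _))// (le_trans _ (ler_wpM2r M0 (geo N)))//
      mulr_suml.
  apply: ler_sum => k _; rewrite normrM [`|t ^+ _|]ger0_norm ?exprn_ge0 ?(ltW t0)//.
  by rewrite mulrC ler_wpM2l ?exprn_ge0 ?(ltW t0).
have e2 : 0 < e / 2 * t ^+ n by rewrite mulr_gt0 ?divr_gt0 ?exprn_gt0.
have /cvgr0Pnorm_lt/(_ _ e2)[N0 _ hN] := b0 t.
have /= := hN (n.+1 + N0)%N (leq_addl _ _).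
rewrite big_split_ord/= big_ord_recr/= big1 ?add0r => [|i _]; last by rewrite IH ?mul0r.
have -> : \sum_(i < N0) b (n.+1 + i)%N * t ^+ (n.+1 + i) =
    (\sum_(i < N0) b (n.+1 + i)%N * t ^+ i.+1) * t ^+ n.
  by rewrite mulr_suml; apply: eq_bigr => i _; rewrite -mulrA -exprD addSnnS addnC.
rewrite -mulrDl normrM [`|t ^+ n|]ger0_norm ?exprn_ge0 ?(ltW t0)//.
rewrite ltr_pM2r ?exprn_gt0// => lt.
rewrite addr0 -[b n](addrK (\sum_(i < N0) b (n.+1 + i)%N * t ^+ i.+1)).
rewrite (le_trans (ler_normB _ _))// [leRHS]splitr lerD ?(ltW lt)//.
by rewrite (le_trans (tail _)).
Unshelve. all: by end_near. Qed.

Lemma cpower_series_inj (b c : nat -> R[i]) (l : R -> R[i]) :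
  (forall t, ccvg (fun N => \sum_(n < N) b n * t%:C ^+ n) (l t)) ->
  (forall t, ccvg (fun N => \sum_(n < N) c n * t%:C ^+ n) (l t)) ->
  forall n, b n = c n.
Proof.
move=> bl cl n; apply/eqP; rewrite -subr_eq0; apply/eqP.
have E t N : \sum_(n < N) b n * t%:C ^+ n - \sum_(n < N) c n * t%:C ^+ n =
    \sum_(n < N) (b n - c n) * (t ^+ n)%:C.
  by rewrite -sumrB; apply: eq_bigr => i _; rewrite -mulrBl rmorphXn.
apply: complex_eq.
  apply: (power_series0 (b := fun n => complex.Re (b n - c n))) => t.
  have /ccvgP[+ _] := bl t; have /ccvgP[+ _] := cl t => cR bR.
  rewrite -[X in _ --> X](subrr (complex.Re (l t))).
  apply: cvg_trans (cvgB bR cR); apply: near_eq_cvg; near=> N.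
  rewrite /= !fctE/= -Re_sub E Re_sum; apply: eq_bigr => i _.
  by rewrite Re_mul/= mulr0 subr0.
apply: (power_series0 (b := fun n => complex.Im (b n - c n))) => t.
have /ccvgP[_ +] := bl t; have /ccvgP[_ +] := cl t => cR bR.
rewrite -[X in _ --> X](subrr (complex.Im (l t))).
apply: cvg_trans (cvgB bR cR); apply: near_eq_cvg; near=> N.
rewrite /= !fctE/= -Im_sub E Im_sum; apply: eq_bigr => i _.
by rewrite Im_mul/= mulr0 add0r.
Unshelve. all: by end_near. Qed.

End power_series.

(** * Gaussian moments *)

Section second_differences.
Variable R : realType.
Implicit Types (f g : R -> R) (h t : R).

(** The sign is chosen so that on [t |-> cos (t x)] it acts as multiplication by [2 - 2 cos (h x)],
    which is nonnegative and close to [(h x)^2]. *)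
Definition second_diff h f t := 2 * f t - f (t + h) - f (t - h).

Lemma eq_iter_second_diff n h f g : f =1 g ->
  iter n (second_diff h) f =1 iter n (second_diff h) g.
Proof. by move=> fg; elim: n => //= n IH t; rewrite /second_diff !IH. Qed.

Lemma iter_second_diffD n h f g t :
  iter n (second_diff h) (f \+ g) t =
  iter n (second_diff h) f t + iter n (second_diff h) g t.
Proof. by elim: n t => //= n IH t; rewrite /second_diff !IH; ring. Qed.

(** Each difference has total weight [2 + 1 + 1 = 4] and widens the window by [h]. *)
Lemma iter_second_diff_bound n h f t (M : R) : 0 <= h ->
  (forall u, `|u - t| <= n%:R * h -> `|f u| <= M) ->
  `|iter n (second_diff h) f t| <= 4 ^+ n * M.
Proof.
move=> h0; elim: n t => [|n IH] t fM /=.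
  by rewrite expr0 mul1r fM// subrr normr0 mul0r.
have nh : 0 <= n%:R * h by rewrite mulr_ge0.
have IHt u : `|u - t| <= h -> `|iter n (second_diff h) f u| <= 4 ^+ n * M.
  move=> ut; apply: IH => v vu; apply: fM.
  rewrite -(subrKA u) (le_trans (ler_normD _ _))// -natr1 mulrDl mul1r lerD//.
rewrite /second_diff (le_trans (ler_normB _ _))//.
rewrite (le_trans (lerD (ler_normB _ _) (lexx _)))// normrM ger0_norm//.
have e1 : `|iter n (second_diff h) f t| <= 4 ^+ n * M by apply: IHt;
    rewrite subrr normr0.
have e2 : `|iter n (second_diff h) f (t + h)| <= 4 ^+ n * M.
  by apply: IHt; rewrite addrAC subrr add0r ger0_norm.
have e3 : `|iter n (second_diff h) f (t - h)| <= 4 ^+ n * M.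
  by apply: IHt; rewrite addrAC subrr add0r normrN ger0_norm.
by rewrite exprS; lra.
Qed.

Lemma size_poly_shift (p : {poly R}) h k : (size p <= k.+1)%N ->
  (size (p \Po ('X + h%:P) - p)%R <= k)%N.
Proof.
move=> pk; have sX : size ('X + h%:P : {poly R}) = 2 by rewrite size_XaddC.
have sp : size (p \Po ('X + h%:P)) = size p by rewrite size_comp_poly2.
apply/leq_sizeP => j; rewrite leq_eqVlt => /orP[/eqP <-|kj]; last first.
  rewrite nth_default// (leq_trans (size_polyD _ _))// size_polyN geq_max sp.
  by rewrite !(leq_trans pk).
rewrite coefB; have [pk1|] := ltnP k (size p); last first.
  by move=> kp; rewrite !nth_default ?subr0// sp.
have kE : k = (size p).-1 by apply/eqP;
    rewrite eqn_leq -ltnS (ltn_predK pk1) pk1/= -ltnS (ltn_predK pk1).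
rewrite kE -/(lead_coef p) -{1}sp -/(lead_coef (p \Po _)) lead_coef_comp ?sX//.
by rewrite lead_coefXaddC expr1n mulr1 subrr.
Qed.

(** A second difference is the composite of two first differences, by [- h] and by [h], each of
    which lowers the degree by cancelling the leading coefficient. *)
Lemma iter_second_diff_poly n h (p : {poly R}) t : (size p <= n.*2)%N ->
  iter n (second_diff h) (fun t => p.[t]) t = 0.
Proof.
elim: n p t => [|n IH] p t; first by rewrite size_poly_leq0 => /eqP -> /=;
    rewrite horner0.
rewrite iterSr doubleS => sp.
pose q := p \Po ('X + (- h)%:P) - p.
pose r := q \Po ('X + h%:P) - q.
rewrite (@eq_iter_second_diff n h _ (fun t => r.[t])).
  by apply: IH; do 2 apply: size_poly_shift.
move=> u; rewrite /second_diff /r /q !(hornerN, hornerD, horner_comp, hornerX, hornerC).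
by rewrite addrK; ring.
Qed.

End second_differences.

Section gaussian_differences.
Variable R : realType.

(** The tail factors because [n! j! <= (n + j)!]. *)
Lemma exp_taylor_le (n : nat) (y : R) :
  `|expR y - \sum_(r < n) y ^+ r / r`!%:R| <= `|y| ^+ n / n`!%:R * expR `|y|.
Proof.
have f0 k : (0 : R) < k`!%:R by rewrite ltr0n fact_gt0.
have tail N : `|\sum_(r < n + N) y ^+ r / r`!%:R - \sum_(r < n) y ^+ r / r`!%:R|
    <= `|y| ^+ n / n`!%:R * expR `|y|.
  rewrite big_split_ord/= addrAC subrr add0r (le_trans (ler_norm_sum _ _ _))//.
  have eN : \sum_(j < N) `|y| ^+ j / j`!%:R <= expR `|y|. by exact: sum_expR_le.
  apply: le_trans (ler_wpM2l _ eN); last by rewrite divr_ge0// exprn_ge0.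
  rewrite mulr_sumr; apply: ler_sum => j _.
  rewrite normrM normrX normfV [`|_%:R|]ger0_norm// exprD mulrACA.
  rewrite ler_wpM2l// ?mulr_ge0 ?exprn_ge0// -invfM lef_pV2 ?posrE ?mulr_gt0//.
  rewrite -natrM ler_nat -(@bin_fact (n + j) n) ?leq_addr// addKn.
  by rewrite leq_pmull// bin_gt0 leq_addr.
have := @cvg_expR_sum _ y; rewrite -(cvg_shiftn n) => ey.
have ly : (fun N => `|\sum_(r < N + n) y ^+ r / r`!%:R - \sum_(r < n) y ^+ r / r`!%:R|)
     @ \oo --> `|expR y - \sum_(r < n) y ^+ r / r`!%:R|.
  by apply: cvg_norm; apply: cvgB => //; exact: cvg_cst.
rewrite -(cvg_lim _ ly)//; apply: limr_le; first by apply/cvg_ex; eexists; exact: ly.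
by near=> N; rewrite addnC tail.
Unshelve. all: by end_near. Qed.

(** The Taylor polynomial of order [n] in [- a t^2] has degree below [2 n] in [t] and is
    annihilated; on the window [|u| <= n h <= 1] the remainder is of order [h^(2 n)]. The constant
    is kept explicit in [n] because the moments have to be summed afterwards. *)
Lemma gaussian_second_diff (a h : R) (n : nat) : 0 <= h -> n%:R * h <= 1 ->
  `|iter n (second_diff h) (fun t => expR (- a * t ^+ 2)) 0| <=
  4 ^+ n * (`|a| * n%:R ^+ 2) ^+ n / n`!%:R * expR `|a| * (h ^+ 2) ^+ n.
Proof.
move=> h0 nh1.
pose p : {poly R} := \sum_(r < n) ((- a) ^+ r / r`!%:R) *: 'X^(r.*2).
have sp : (size p <= n.*2)%N.
  apply: (leq_trans (size_sum _ _ _)); apply/bigmax_leqP => r _.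
  by rewrite (leq_trans (size_scale_leq _ _))// size_polyXn ltn_double.
have pE t : p.[t] = \sum_(r < n) (- a * t ^+ 2) ^+ r / r`!%:R.
  rewrite horner_sum; apply: eq_bigr => r _.
  by rewrite hornerZ hornerXn exprMn -exprM mul2n mulrAC.
rewrite (@eq_iter_second_diff _ _ _ _ ((fun t => p.[t]) \+
    (fun t => expR (- a * t ^+ 2) - p.[t]))); last first.
  by move=> t /=; rewrite addrC subrK.
rewrite iter_second_diffD iter_second_diff_poly// add0r.
have nh0 : 0 <= n%:R * h by rewrite mulr_ge0.
apply: le_trans (_ : _ <= 4 ^+ n * ((`|a| * (n%:R * h) ^+ 2) ^+ n / n`!%:R * expR
    `|a|)) _.
  apply: iter_second_diff_bound => // u; rewrite subr0 => un.
  rewrite pE (le_trans (exp_taylor_le _ _))// normrM normrN normrX.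
  have u2 : `|u| ^+ 2 <= (n%:R * h) ^+ 2 by rewrite ler_sqr ?nnegrE.
  have u1 : `|u| ^+ 2 <= 1 by rewrite (le_trans u2)// exprn_ile1.
  rewrite ler_pM ?expR_ge0 ?divr_ge0 ?exprn_ge0 ?mulr_ge0//.
    rewrite ler_wpM2r ?invr_ge0// lerXn2r ?nnegrE ?mulr_ge0 ?exprn_ge0//.
    by rewrite ler_wpM2l.
  by rewrite ler_expR ler_piMr.
rewrite le_eqVlt; apply/orP; left; apply/eqP.
by rewrite !exprMn; ring.
Qed.

End gaussian_differences.

(** The numerator is [4 sin(h x / 2)^2], and [sin u / u] tends to the derivative of [sin] at 0. The
    shift by [n] in the steps [h = 1 / (n + k + 1)] ensures [n h <= 1], as [gaussian_second_diff]
    requires. *)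
Lemma cvg_sin_quotient (R : realType) (n : nat) (x : R) :
  (fun k => (2 - 2 * cos ((n + k).+1%:R^-1 * x)) / (n + k).+1%:R^-1 ^+ 2) @ \oo --> x
      ^+ 2.
Proof.
pose h (k : nat) : R := (n + k).+1%:R^-1.
have hn0 k : h k != 0 by rewrite invr_eq0 pnatr_eq0.
(* The general case divides by [h x / 2]. *)
have [->|x0] := eqVneq x 0.
  by apply: cvg_near_cst; near=> k; rewrite mulr0 cos0 mulr1 subrr mul0r expr0n.
have D : (fun u : R => u^-1 * sin u) @ 0^' --> (1 : R).
  have [dsin vsin] := is_derive_sin (0 : R).
  rewrite -(@cos0 R) -vsin /derive; apply: cvg_trans dsin.
  apply: near_eq_cvg; near=> u => /=.
  by rewrite /shift/= addr0 sin0 subr0 [u *: 1]mulr1.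
have hx : (fun k => h k * (x / 2)) @ \oo --> (0 : R).
  rewrite -(mul0r (x / 2)); apply: cvgM; last exact: cvg_cst.
  apply: (@cvg_comp _ _ _ (addn n) (@harmonic R) _ \oo); last exact: cvg_harmonic.
  exact: cvg_addnl.
have hx' : (fun k => h k * (x / 2)) @ \oo --> (0 : R)^'.
  move=> A HA; have HA' : \forall k \near \oo, h k * (x / 2) != 0 -> A (h k * (x / 2)).
    exact: hx _ HA.
  suff : \forall k \near \oo, A (h k * (x / 2)) by [].
  by apply: filterS HA' => k; apply; rewrite !mulf_neq0// invr_eq0.
have L := cvg_comp _ _ hx' D.
have L2 : (fun k => x ^+ 2 * (((h k * (x / 2))^-1 * sin (h k * (x / 2))) *
    ((h k * (x / 2))^-1 * sin (h k * (x / 2))))) @ \oo --> x ^+ 2 * (1 * 1).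
  by apply: cvgM; [exact: cvg_cst|apply: cvgM; exact: L].
rewrite !mulr1 in L2.
apply: cvg_trans L2; apply: near_eq_cvg; near=> k => /=.
rewrite -/(h k); have -> : h k * x = (h k * (x / 2)) *+ 2 by rewrite -mulr_natr; field.
rewrite cos_mulr2n cos2sin2; field.
by rewrite x0 hn0.
Unshelve. all: by end_near. Qed.

Section gaussian_moments.
Context d (T : measurableType d) (R : realType) (P : probability T R).
Variables (X : T -> R) (a : R).
Hypothesis mX : measurable_fun setT X.
Hypothesis charX : forall t, Rintegral P setT (fun x => cos (t * X x)) = expR (- a * t
    ^+ 2).

(** The [n]-fold [second_diff] of [t |-> cos (t X)]; integrating it gives the same difference of the
    characteristic function. *)
Let trig (h : R) n (t : R) x := (2 - 2 * cos (h * X x)) ^+ n * cos (t * X x).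

Let measurable_cosX t : measurable_fun setT (fun x => cos (t * X x)).
Proof.
apply: (measurableT_comp (f := @cos R) (g := fun x => t * X x)).
  by apply: continuous_measurable_fun; exact: continuous_cos.
by apply: measurable_funM => //; exact: measurable_cst.
Qed.

Let measurable_base h n : measurable_fun setT (fun x => (2 - 2 * cos (h * X x)) ^+ n).
Proof.
apply: measurable_funX; apply: measurable_funB; first exact: measurable_cst.
by apply: measurable_funM => //; exact: measurable_cst.
Qed.

Let base_bound h x : 0 <= 2 - 2 * cos (h * X x) <= 4.
Proof. by have := cos_le1 (h * X x); have := cos_geN1 (h * X x); lra. Qed.

Let trig_integrable h n t : P.-integrable setT (EFin \o trig h n t).
Proof.
apply: measurable_bounded_integrable => //.
- by rewrite (le_lt_trans (probability_le1 _ _))// ltry.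
- by apply: measurable_funM.
- exists (4 ^+ n); split; first exact: num_real.
  move=> M M4 x _ /=; rewrite (le_trans _ (ltW M4))// normrM normrX.
  have /andP[b0 b4] := base_bound h x; rewrite -[leRHS]mulr1 ler_pM ?exprn_ge0//.
    by rewrite ger0_norm// lerXn2r ?nnegrE.
  by rewrite ler_norml cos_le1 cos_geN1.
Qed.

Let trig_integral h n t : Rintegral P setT (trig h n t) =
  iter n (second_diff h) (fun t => expR (- a * t ^+ 2)) t.
Proof.
elim: n t => [|n IH] t /=.
  by rewrite -charX; apply: eq_Rintegral => x _; rewrite /trig expr0 mul1r.
have i2 : P.-integrable setT (EFin \o (fun x => 2 * trig h n t x)).
  have := integrableZl measurableT 2 (trig_integrable h n t).
  by apply: eq_integrable => // x _ /=; rewrite EFinM.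
have i3 : P.-integrable setT (EFin \o (fun x => 2 * trig h n t x - trig h n (t + h) x)).
  have := integrableB measurableT i2 (trig_integrable h n (t + h)).
  by apply: eq_integrable => // x _ /=; rewrite EFinB.
transitivity (Rintegral P setT
    (fun x => 2 * trig h n t x - trig h n (t + h) x - trig h n (t - h) x)).
  apply: eq_Rintegral => x _; rewrite /trig exprS.
  have -> : (t + h) * X x = t * X x + h * X x by ring.
  have -> : (t - h) * X x = t * X x - h * X x by ring.
  by rewrite cosB cosD; ring.
rewrite RintegralB// RintegralB// RintegralZl// !IH//.
Qed.

(** The power [h^(2 n)] in [gaussian_second_diff] cancels the denominator of the difference
    quotient, so the bound is uniform in the step and passes to the limit. *)
Lemma gaussian_moment_le n :
  (\int[P]_x (X x ^+ n.*2)%:E <=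
   (4 ^+ n * (`|a| * n%:R ^+ 2) ^+ n / n`!%:R * expR `|a|)%:E)%E.
Proof.
pose h k : R := (n + k).+1%:R^-1.
have h0 k : 0 < h k by rewrite invr_gt0.
pose f k x := ((2 - 2 * cos (h k * X x)) / h k ^+ 2) ^+ n.
have mf k : measurable_fun setT (EFin \o f k).
  apply/measurable_EFinP; rewrite /f; under eq_fun do rewrite exprMn.
  by apply: measurable_funM => //; exact: measurable_cst.
have f0 k x : 0 <= f k x.
  by have /andP[? _] := base_bound (h k) x;
      rewrite exprn_ge0// divr_ge0// exprn_ge0// ltW.
have lf x : limn_einf (fun k => (f k x)%:E) = (X x ^+ n.*2)%:E.
  apply: (cvg_limn_einf_sup _).1; apply: cvg_EFin; first by near=> k.
  rewrite -mul2n exprM.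
  exact: (@continuous_cvg _ _ _ \oo _ _ (fun y : R => y ^+ n) _
    (@exprn_continuous R n (X x ^+ 2)) (@cvg_sin_quotient R n (X x))).
under eq_integral do rewrite -lf.
apply: le_trans (fatou _ _ _ _) _ => //; first by move=> k x _; rewrite lee_fin f0.
rewrite limn_einf_lim; apply: lime_le; first exact: is_cvg_einfs.
near=> k; apply: le_trans; first by apply: ereal_inf_lbound; exists k => /=.
have E x : f k x = (h k ^+ 2) ^- n * trig (h k) n 0 x.
  by rewrite /f /trig mul0r cos0 mulr1 exprMn exprVn mulrC.
have itrig := trig_integrable (h k) n 0.
have ifk : P.-integrable setT (EFin \o f k).
  have := integrableZl measurableT ((h k ^+ 2) ^- n) itrig.
  by apply: eq_integrable => // x _ /=; rewrite E EFinM.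
rewrite -[leLHS]fineK; last exact: integrable_fin_num.
rewrite lee_fin -[leLHS]/(Rintegral P setT (f k)).
have -> : Rintegral P setT (f k) =
    Rintegral P setT (fun x => (h k ^+ 2) ^- n * trig (h k) n 0 x).
  by apply: eq_Rintegral => x _; exact: E.
rewrite RintegralZl// trig_integral mulrC ler_pdivrMr ?exprn_gt0//.
rewrite (le_trans (ler_norm _))// gaussian_second_diff//; first exact: ltW.
by rewrite ler_pdivrMr// mul1r ler_nat -addnS leq_addr.
Unshelve. all: by end_near. Qed.

(** [exp(s |X|)] is at most [exp(s X) + exp(- s X)], whose series [f] involves only even moments and
    can be integrated term by term. *)
Lemma gaussian_exp_moment (s : R) :
  (\int[P]_x (expR (s * `|X x|))%:E < +oo)%E.
Proof.
pose f n x := 2 * (s * X x) ^+ n.*2 / n.*2`!%:R.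
have f0 n x : 0 <= f n x.
  by rewrite divr_ge0// mulr_ge0// -mul2n exprM exprn_ge0// sqr_ge0.
have mXn n : measurable_fun setT (fun x => (X x ^+ n.*2)%:E).
  by apply/measurable_EFinP; exact: measurable_funX.
have fE n x : (f n x)%:E = ((2 * s ^+ n.*2 / n.*2`!%:R)%:E * (X x ^+ n.*2)%:E)%E.
  by rewrite -EFinM /f exprMn; congr (_%:E); ring.
have mf n : measurable_fun setT (fun x => (f n x)%:E).
  by under eq_fun do rewrite fE; exact: measurable_funeM.
have cosh_le x : ((expR (s * `|X x|))%:E <= \sum_(0 <= n <oo) (f n x)%:E)%E.
  set y := s * X x.
  have ey : (fun N => (\sum_(n < N) y ^+ n / n`!%:R + \sum_(n < N) (- y) ^+ n /
      n`!%:R)%:E)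
      @ \oo --> (expR y + expR (- y))%:E.
    apply: cvg_EFin; first by near=> N.
    by apply: cvgD; exact: cvg_expR_sum.
  apply: (@le_trans _ _ (expR y + expR (- y))%:E).
    rewrite lee_fin; apply: (@le_trans _ _ (expR `|y|)).
      by rewrite ler_expR /y normrM ler_wpM2r// ler_norm.
    by case: (ger0P y) => _; rewrite ?lerDl ?lerDr expR_ge0.
  rewrite -(cvg_lim _ ey)//; apply: lime_le; first by apply/cvg_ex; eexists; exact: ey.
  near=> N.
  have -> : \sum_(n < N) y ^+ n / n`!%:R + \sum_(n < N) (- y) ^+ n / n`!%:R =
      \sum_(n < uphalf N) f n x.
    rewrite -(big_even (fun n => f n x)) -big_split/=; apply: eq_bigr => n _.
    rewrite -mulrDl exprNn -signr_odd /f -/y; case: ifP => nodd /=.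
      by rewrite mulN1r subrr mul0r.
    by rewrite -[in RHS](odd_double_half n) nodd add0n !doubleK mul1r -[in
        LHS](odd_double_half n) nodd add0n; ring.
  rewrite -sumEFin -(big_mkord xpredT (fun n => (f n x)%:E)).
  by apply: nneseries_lim_ge => n _ _; rewrite lee_fin.
(* Used with [u = n] and [k = 2 n]: then [n^(2 n) / (2 n)! <= e^n], which takes the place of
   Stirling's formula and is the origin of [expR 1] in [c]. *)
have xk (k : nat) (u : R) : 0 <= u -> u ^+ k / k`!%:R <= expR u.
  case: k => [|k] u0; first by rewrite expr0 divr1 -expR0 ler_expR.
  by rewrite (le_trans _ (expR_ge1Dxn k u0))// lerDr.
pose c := 4 * `|a| * s ^+ 2 * expR 1.
have c0 : 0 <= c.
  by rewrite mulr_ge0 ?expR_ge0// mulr_ge0 ?sqr_ge0// mulr_ge0.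
have bnd n : (\int[P]_x (f n x)%:E <= (2 * expR `|a| * (c ^+ n / n`!%:R))%:E)%E.
  under eq_integral do rewrite fE.
  have s2n : 0 <= 2 * s ^+ n.*2 / n.*2`!%:R.
    by rewrite divr_ge0// mulr_ge0// -mul2n exprM exprn_ge0// sqr_ge0.
  rewrite ge0_integralZl//=; last by move=> x _;
      rewrite lee_fin -mul2n exprM exprn_ge0// sqr_ge0.
  apply: le_trans (lee_wpmul2l _ (gaussian_moment_le n)) _; first by rewrite lee_fin.
  rewrite -EFinM lee_fin.
  have -> : 2 * s ^+ n.*2 / n.*2`!%:R * (4 ^+ n * (`|a| * n%:R ^+ 2) ^+ n / n`!%:R *
      expR `|a|) =
      (2 * expR `|a| * ((4 * `|a| * s ^+ 2) ^+ n / n`!%:R)) * (n%:R ^+ n.*2 /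
          n.*2`!%:R).
    by rewrite -!mul2n !exprM !exprMn; ring.
  have -> : 2 * expR `|a| * (c ^+ n / n`!%:R) =
      (2 * expR `|a| * ((4 * `|a| * s ^+ 2) ^+ n / n`!%:R)) * expR n%:R.
    by rewrite /c exprMn -expRM_natl mulr1; ring.
  apply: ler_wpM2l; last exact: xk.
  apply: mulr_ge0; first by rewrite mulr_ge0 ?expR_ge0.
  by rewrite divr_ge0// exprn_ge0// mulr_ge0 ?sqr_ge0// mulr_ge0.
apply: (@le_lt_trans _ _ (\int[P]_x \sum_(0 <= n <oo) (f n x)%:E)%E).
  apply: ge0_le_integral => //.
  - apply/measurable_EFinP; apply: (measurableT_comp (f := @expR R)) => //.
    by apply: measurable_funM => //; exact: measurableT_comp.
  - by apply: ge0_emeasurable_sum => // n x _ _; rewrite lee_fin.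
rewrite integral_nneseries//; last by move=> n x _; rewrite lee_fin.
apply: (@le_lt_trans _ _ (2 * expR `|a| * expR c)%:E); last exact: ltry.
apply: lime_le.
  by apply: is_cvg_nneseries => n _ _; apply: integral_ge0 => x _; rewrite lee_fin.
near=> N; apply: le_trans; first by apply: lee_sum => n _; exact: bnd.
rewrite sumEFin lee_fin big_mkord -mulr_sumr ler_wpM2l ?mulr_ge0 ?expR_ge0//.
exact: sum_expR_le.
Unshelve. all: by end_near. Qed.

End gaussian_moments.

(** * Finitely supported matrices and tensors *)

Section finite_support.
Variables (R : realType) (d : nat).
Implicit Types (A F G : Mdual R d) (K n : nat).

(** One corner for all components, in which the infinite index sums become sums over ordinals. *)
Definition herm_bounded K F :=
  forall c i j, F c i j != 0 -> (i < K)%N && (j < K)%N.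

Lemma Mfin_bounded F : Mfin F -> exists K, herm_bounded K F.
Proof.
move=> finF.
have /choice[s sE] : forall c, exists s : seq (nat * nat),
    [set ij : nat * nat | F c ij.1 ij.2 != 0] = [set` s].
  by move=> c; have /finite_seqP[s sE] := finF c; exists s.
exists (\max_c \max_(ij <- s c) maxn ij.1 ij.2).+1 => c i j Fij.
have ijs : (i, j) \in s c.
  by have : [set ij : nat * nat | F c ij.1 ij.2 != 0] (i, j) by []; rewrite sE.
have le : (maxn i j <= \max_c \max_(ij <- s c) maxn ij.1 ij.2)%N.
  rewrite (leq_trans _ (leq_bigmax_cond _ (isT : xpredT c)))//.
  exact: (@leq_bigmax_seq _ (s c) xpredT (fun ij : nat * nat => maxn ij.1 ij.2) _ ijs).
by rewrite !ltnS; move: le; rewrite geq_max.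
Qed.

Lemma bounded_Mfin K F : herm_bounded K F -> Mfin F.
Proof.
move=> bF c; apply: (@sub_finite_set _ _ ([set` iota 0 K] `*` [set` iota 0 K])).
  by move=> [i j] /= /bF /andP[iK jK]; rewrite !mem_iota.
by apply: finite_setX; exact: finite_seq.
Qed.

Lemma herm_bounded_le K K' F : (K <= K')%N -> herm_bounded K F -> herm_bounded K' F.
Proof. by move=> KK bF c i j /bF /andP[? ?]; rewrite !(leq_trans _ KK). Qed.

Lemma fsum_image (V : nmodType) (I : choiceType) (J : finType) (h : J -> I) (f : I ->
    V) :
  injective h -> (forall i, f i != 0 -> exists j, i = h j) ->
  \sum_(i \in [set: I]) f i = \sum_j f (h j).
Proof.
move=> hinj fh; rewrite -(@fsbig_widen _ _ _ _ [set` [seq h j | j <- enum J]])//.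
  have ur : uniq [seq h j | j <- enum J] by rewrite (map_inj_uniq hinj) enum_uniq.
  by rewrite -(fsbig_seq _ _ ur) big_map big_enum.
move=> i [_ /negP ni] /=; apply/eqP/negPn/negP => /fh[j ij]; case/negP: ni.
by rewrite ij map_f// mem_enum.
Qed.

Lemma pairing_bounded K A F : herm_bounded K F ->
  pairing A F = \sum_c \sum_(i < K) \sum_(j < K) A c i j * F c j i.
Proof.
move=> bF; apply: eq_bigr => c _; rewrite pair_big/=.
rewrite (@fsum_image _ _ _ (fun ij : 'I_K * 'I_K => (ij.1 : nat, ij.2 : nat)))//.
  by move=> [i j] [i' j'] /= [] /ord_inj -> /ord_inj ->.
move=> [i j] /= AF; have /bF/andP[jK iK] : F c j i != 0.
  by apply: contra AF => /eqP ->; rewrite mulr0.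
by exists (Ordinal iK, Ordinal jK).
Qed.

Lemma pairing_conj A F : Mfin F -> conjc (pairing A F) = pairing A F.
Proof.
move=> /Mfin_bounded[K bF]; rewrite (pairing_bounded _ bF) rmorph_sum.
apply: eq_bigr => c _; rewrite rmorph_sum exchange_big/=.
apply: eq_bigr => i _; rewrite rmorph_sum/=; apply: eq_bigr => j _.
by rewrite rmorphM/= -!entryJ.
Qed.

Lemma pairing_real A F : Mfin F -> pairing A F = (complex.Re (pairing A F))%:C.
Proof.
move=> /(pairing_conj A); case: (pairing A F) => x y /= [] /eqP.
by rewrite eqNr => /eqP ->.
Qed.

Lemma lincomb_subproof (I : finType) (t : I -> R) (F : I -> Defs.hermitian R) i j :
  \sum_k (t k)%:C * F k j i = conjc (\sum_k (t k)%:C * F k i j).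
Proof.
rewrite rmorph_sum; apply: eq_bigr => k _.
by rewrite rmorphM/= oppr0 -entryJ.
Qed.

(** Real coefficients preserve the Hermitian symmetry. Scalings along a ray and the partial sums of
    polarization are both instances. *)
Definition lincomb (I : finType) (t : I -> R) (F : I -> Mdual R d) : Mdual R d :=
  fun c => Defs.Hermitian (lincomb_subproof t (fun k => F k c)).

Lemma lincomb_bounded K (I : finType) (t : I -> R) (F : I -> Mdual R d) :
  (forall k, herm_bounded K (F k)) -> herm_bounded K (lincomb t F).
Proof.
move=> bF c i j /=; apply: contraR => ij; apply/eqP/big1 => k _.
by apply/eqP; rewrite mulf_eq0; apply/orP; right; apply: contraR ij => /bF.
Qed.

Lemma Mfin_bounded_all (I : finType) (F : I -> Mdual R d) :
  (forall k, Mfin (F k)) -> exists K, forall k, herm_bounded K (F k).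
Proof.
move=> finF; have /choice[K bK] := fun k => Mfin_bounded (finF k).
by exists (\max_k K k)%N => k; apply: herm_bounded_le (bK k); exact: leq_bigmax.
Qed.

Lemma Mfin_lincomb (I : finType) (t : I -> R) (F : I -> Mdual R d) :
  (forall k, Mfin (F k)) -> Mfin (lincomb t F).
Proof.
by move=> /Mfin_bounded_all[K bK]; apply: (@bounded_Mfin K); exact: lincomb_bounded.
Qed.

Lemma pairing_lincomb (I : finType) (t : I -> R) (F : I -> Mdual R d) A :
  (forall k, Mfin (F k)) ->
  pairing A (lincomb t F) = \sum_k (t k)%:C * pairing A (F k).
Proof.
move=> /Mfin_bounded_all[K bK]; rewrite (pairing_bounded A (lincomb_bounded bK)).
under [RHS]eq_bigr do rewrite (pairing_bounded _ (bK _)) mulr_sumr.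
rewrite [RHS]exchange_big; apply: eq_bigr => c _.
under [RHS]eq_bigr do rewrite mulr_sumr.
rewrite [RHS]exchange_big; apply: eq_bigr => i _.
under [RHS]eq_bigr do rewrite mulr_sumr.
rewrite [RHS]exchange_big; apply: eq_bigr => j _ /=.
by rewrite mulr_sumr; apply: eq_bigr => k _; rewrite mulrCA.
Qed.

Definition hscale (t : R) F : Mdual R d := lincomb (fun _ : unit => t) (fun=> F).

Lemma hscaleE t F c i j : hscale t F c i j = t%:C * F c i j.
Proof. by rewrite /= (big_pred1 tt)//; case. Qed.

Lemma Mfin_hscale t F : Mfin F -> Mfin (hscale t F).
Proof. by move=> finF; exact: Mfin_lincomb. Qed.

Lemma pairing_hscaler t A F : pairing A (hscale t F) = t%:C * pairing A F.
Proof.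
rewrite /pairing mulr_sumr; apply: eq_bigr => c _; rewrite mulr_fsumr.
by apply: eq_fsbigr => ij _; rewrite hscaleE mulrCA.
Qed.

Lemma pairing_hscalel t A F : pairing (hscale t A) F = t%:C * pairing A F.
Proof.
rewrite /pairing mulr_sumr; apply: eq_bigr => c _; rewrite mulr_fsumr.
by apply: eq_fsbigr => ij _; rewrite hscaleE mulrA.
Qed.

Lemma mattr_matmul_hscale t F G c c' :
  mattr (matmul (hscale t F c) (hscale t G c')) = t%:C ^+ 2 * mattr (matmul (F c) (G
      c')).
Proof.
rewrite /mattr mulr_fsumr; apply: eq_fsbigr => i _; rewrite /matmul mulr_fsumr.
by apply: eq_fsbigr => j _; rewrite !hscaleE mulrACA.
Qed.

Section tensors.
Variable n : nat.
Implicit Types (k : tensor R d n) (x : n.-tuple (multi_index d)).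

Definition in_box K x :=
  [forall a, ((tnth x a).1.2 < K)%N && ((tnth x a).2 < K)%N].

Definition box_supported K k := forall x, k x != 0 -> in_box K x.

Lemma in_box_le K K' x : (K <= K')%N -> in_box K x -> in_box K' x.
Proof.
move=> KK /forallP bx; apply/forallP => a; have /andP[? ?] := bx a.
by rewrite !(leq_trans _ KK).
Qed.

Lemma box_supported_le K K' k : (K <= K')%N -> box_supported K k -> box_supported K' k.
Proof. by move=> KK bk x /bk; exact: in_box_le. Qed.

Definition box_index K (y : n.-tuple (component d * 'I_K * 'I_K)) :
    n.-tuple (multi_index d) :=
  map_tuple (fun j : component d * 'I_K * 'I_K => (j.1.1, j.1.2 : nat, j.2 : nat)) y.

Lemma box_index_inj K : injective (@box_index K).
Proof.
move=> y y' /(congr1 val)/= /inj_map yy; apply: val_inj; apply: yy.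
by move=> [[c i] j] [[c' i'] j'] /= [] -> /ord_inj -> /ord_inj ->.
Qed.

Lemma in_boxP K x : in_box K x -> exists y, x = @box_index K y.
Proof.
move=> /forallP bx.
have b1 a : ((tnth x a).1.2 < K)%N by have /andP[] := bx a.
have b2 a : ((tnth x a).2 < K)%N by have /andP[] := bx a.
exists [tuple ((tnth x a).1.1, Ordinal (b1 a), Ordinal (b2 a)) | a < n].
apply: eq_from_tnth => a; rewrite tnth_map tnth_mktuple/=.
by case: (tnth x a) => [[]].
Qed.

Lemma in_box_swap K x : in_box K (map_tuple (@swap_index d) x) = in_box K x.
Proof. by apply: eq_forallb => a; rewrite tnth_map/= andbC. Qed.

Lemma tpairing_box K (u v : tensor R d n) : box_supported K v ->
  tpairing u v = \sum_(y : n.-tuple (component d * 'I_K * 'I_K))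
    u (box_index y) * v (map_tuple (@swap_index d) (box_index y)).
Proof.
move=> bv; rewrite /tpairing (fsum_image (@box_index_inj K))// => x ux.
apply: in_boxP; rewrite -in_box_swap; apply: bv.
by apply: contra ux => /eqP ->; rewrite mulr0.
Qed.

Lemma tpairing_lin K (u v w : tensor R d n) (a : R[i]) :
  box_supported K v -> box_supported K w ->
  tpairing u (fun x => a * v x + w x) = a * tpairing u v + tpairing u w.
Proof.
move=> bv bw; rewrite (tpairing_box _ bv) (tpairing_box _ bw).
rewrite (@tpairing_box K); last first.
  move=> x; apply: contraR => nx;
      have z (k : tensor R d n) : box_supported K k -> k x = 0.
    by move=> bk; apply/eqP; apply: contraR nx => /bk.
  by rewrite (z v bv) (z w bw) mulr0 addr0.
rewrite mulr_sumr -big_split; apply: eq_bigr => y _ /=.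
by rewrite mulrDr mulrCA.
Qed.

Lemma tpairingZ (u v : tensor R d n) (a : R[i]) :
  tpairing u (fun x => a * v x) = a * tpairing u v.
Proof. by rewrite /tpairing mulr_fsumr; apply: eq_fsbigr => x _; rewrite mulrCA. Qed.

Lemma truncate_supported K K' k : box_supported K k -> (K <= K')%N ->
  truncate k K' = k.
Proof.
move=> bk KK; apply/funext => x; rewrite /truncate -/(in_box K' x); case: ifPn => // nx.
by apply/esym/eqP; apply: contraR nx => /(box_supported_le KK bk).
Qed.

Lemma tpow_supported K F : herm_bounded K F -> box_supported K (tpow n F).
Proof.
move=> bF x; rewrite /tpow => /prodf_neq0 nz; apply/forallP => a.
exact: bF (nz a isT).
Qed.

Lemma tpow_hscale t F x : tpow n (hscale t F) x = t%:C ^+ n * tpow n F x.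
Proof.
transitivity (\prod_(a < n) (t%:C * Defs.coord F (tnth x a))).
  by apply: eq_bigr => a _; exact: hscaleE.
by rewrite big_split/= prodr_const card_ord.
Qed.

Lemma tpow_symmetric F : symmetric_tensor (tpow n F).
Proof.
move=> s x; rewrite /tpow [RHS](reindex_inj (@perm_inj _ s))/=.
by apply: eq_bigr => a _; rewrite tnth_mktuple.
Qed.

Lemma tnorm2_box (p : nat -> nat -> R) K k : (forall i j, 0 <= p i j) ->
  box_supported K k ->
  tnorm2 p k = (\sum_(y : n.-tuple (component d * 'I_K * 'I_K))
    (\prod_(a < n) p (tnth y a).1.2 (tnth y a).2 * normc (k (box_index y)) ^+ 2))%:E.
Proof.
move=> p0 bk; pose g x := (\prod_(a < n) p (tnth x a).1.2 (tnth x a).2) * normc (k x)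
    ^+ 2.
have g0 x : 0 <= g x by rewrite mulr_ge0 ?sqr_ge0// prodr_ge0.
have fin : finite_set [set` [seq box_index y | y <- enum {: n.-tuple (component d *
    'I_K * 'I_K)}]].
  exact: finite_seq.
rewrite /tnorm2 -sumEFin.
rewrite (_ : \esum_(x in _) _ = \esum_(x in [set` [seq @box_index K y | y <- enum {:
    n.-tuple (component d * 'I_K * 'I_K)}]]) (g x)%:E)%E; last first.
  rewrite [RHS]esum_mkcond; apply: eq_esum => x _; case: ifPn => // /negP nx.
  have k0 : k x = 0.
    apply/eqP/negPn/negP => /bk/in_boxP[y xy]; apply: nx.
    by rewrite inE/= xy map_f// mem_enum.
  by rewrite k0 normc0 expr0n mulr0.
rewrite esum_fset//; last by move=> x _; rewrite lee_fin.
have ur : uniq [seq @box_index K y | y <- enum {: n.-tuple (component d * 'I_K *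
    'I_K)}].
  by rewrite (map_inj_uniq (@box_index_inj K)) enum_uniq.
rewrite -(fsbig_seq _ _ ur) big_map big_enum; apply: eq_bigr => y _; rewrite /g;
    congr (_ * _)%:E.
by apply: eq_bigr => a _; rewrite tnth_map.
Qed.

End tensors.

(** What matters is growth at most geometric in [n], with one base for all orders. The sum [M] is
    [|F|_p^2]; bounding every term by [M^n] costs the number of indices in the box as an extra
    factor of the base. *)
Lemma tnorm2_tpow (p : nat -> nat -> R) F : (forall i j, 0 <= p i j) -> Mfin F ->
  exists2 B : R, 0 <= B & forall n (c : R[i]),
    (tnorm2 p (fun x => (c * tpow n F x)%R) <= (normc c ^+ 2 * B ^+ n)%:E)%E.
Proof.
move=> p0 /Mfin_bounded[K bF].
pose w (j : component d * 'I_K * 'I_K) := p j.1.2 j.2 * normc (F j.1.1 j.1.2 j.2) ^+ 2.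
have w0 j : 0 <= w j by rewrite mulr_ge0 ?sqr_ge0.
pose M := \sum_j w j.
have M0 : 0 <= M by exact: sumr_ge0.
have wM j : w j <= M by rewrite /M (bigD1 j)//= lerDl sumr_ge0.
exists (#|{: component d * 'I_K * 'I_K}|%:R * M) => [|n c]; first by rewrite mulr_ge0.
rewrite (@tnorm2_box _ _ K)//; last first.
  move=> x; have /(_ x) := @tpow_supported n K F bF => h cx; apply: h.
  by apply: contra cx => /eqP ->; rewrite mulr0.
rewrite lee_fin (@le_trans _ _ (\sum_(y : n.-tuple (component d * 'I_K * 'I_K)) normc c
    ^+ 2 * M ^+ n))//.
  apply: ler_sum => y _.
  have -> : \prod_(a < n) p (tnth y a).1.2 (tnth y a).2 * normc (c * tpow n F
      (box_index y)) ^+ 2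
    = normc c ^+ 2 * \prod_(a < n) w (tnth y a).
    rewrite normcM exprMn mulrCA big_split/=; congr (_ * (_ * _)).
    rewrite /tpow (big_morph (@normc R) (@normcM R) (@normc1 R)) -prodrXl.
    by apply: eq_bigr => a _; rewrite tnth_map.
  rewrite ler_wpM2l ?sqr_ge0// -[in leRHS](card_ord n) -prodr_const.
  by apply: ler_prod => a _; rewrite w0 wM.
rewrite sumr_const -[leLHS]mulr_natl card_tuple natrX exprMn.
by rewrite mulrCA.
Qed.

End finite_support.

(** * Square-integrable Hermite series *)

Section complex_functions.
Context dT (T : measurableType dT) (R : realType).
Implicit Types (f g : T -> R[i]).

Definition cmeasurable f :=
  measurable_fun setT (fun x => complex.Re (f x)) /\
  measurable_fun setT (fun x => complex.Im (f x)).

Lemma cmeasurable_cst (z : R[i]) : cmeasurable (fun=> z).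
Proof. by split; exact: measurable_cst. Qed.

Lemma cmeasurableD f g : cmeasurable f -> cmeasurable g -> cmeasurable (fun x => f x +
    g x).
Proof.
move=> [rf imf] [rg img]; split.
  by under eq_fun do rewrite Re_add; exact: measurable_funD.
by under eq_fun do rewrite Im_add; exact: measurable_funD.
Qed.

Lemma cmeasurableM f g : cmeasurable f -> cmeasurable g -> cmeasurable (fun x => f x *
    g x).
Proof.
move=> [rf imf] [rg img]; split.
  under eq_fun do rewrite Re_mul.
  by apply: measurable_funB; apply: measurable_funM.
under eq_fun do rewrite Im_mul.
by apply: measurable_funD; apply: measurable_funM.
Qed.

Lemma cmeasurableX f n : cmeasurable f -> cmeasurable (fun x => f x ^+ n).
Proof.
move=> mf; elim: n => [|n IH].
  by rewrite (_ : (fun x => _) = fun=> 1)//; exact: cmeasurable_cst.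
by under eq_fun do rewrite exprS; exact: cmeasurableM.
Qed.

Lemma cmeasurable_sum (I : Type) (r : seq I) (h : I -> T -> R[i]) :
  (forall i, cmeasurable (h i)) -> cmeasurable (fun x => \sum_(i <- r) h i x).
Proof.
move=> mh; split.
  by under eq_fun do rewrite Re_sum; apply: measurable_sum => i; exact: (mh i).1.
by under eq_fun do rewrite Im_sum; apply: measurable_sum => i; exact: (mh i).2.
Qed.

Lemma cmeasurableB f g : cmeasurable f -> cmeasurable g -> cmeasurable (fun x => f x -
    g x).
Proof.
move=> mf mg; rewrite (_ : (fun x => _) = fun x => f x + (-1) * g x); last first.
  by apply/funext => x; rewrite mulN1r.
by apply: cmeasurableD => //; apply: cmeasurableM => //; exact: cmeasurable_cst.
Qed.

Lemma measurable_normc2 f : cmeasurable f ->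
  measurable_fun setT (fun x => (normc (f x) ^+ 2)%:E).
Proof.
move=> [rf imf]; apply/measurable_EFinP; under eq_fun do rewrite normcE2.
by apply: measurable_funD; exact: measurable_funX.
Qed.

(** From [|a f + g|^2 <= 2 |a f|^2 + 2 |g|^2]. *)
Lemma normc2_integral_lin (P : {measure set T -> \bar R}) f g (a : R[i]) :
  cmeasurable f -> cmeasurable g ->
  (\int[P]_x (normc (f x) ^+ 2)%:E < +oo)%E ->
  (\int[P]_x (normc (g x) ^+ 2)%:E < +oo)%E ->
  (\int[P]_x (normc (a * f x + g x)%R ^+ 2)%:E < +oo)%E.
Proof.
move=> mf mg f2 g2.
have m2f := measurable_normc2 mf; have m2g := measurable_normc2 mg.
have n2 (h : T -> R[i]) x : (0 <= (normc (h x) ^+ 2)%:E)%E by rewrite lee_fin sqr_ge0.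
apply: (@le_lt_trans _ _ (\int[P]_x ((2 * normc a ^+ 2)%:E * (normc (f x) ^+ 2)%:E +
    2%:E * (normc (g x) ^+ 2)%:E))%E).
  apply: ge0_le_integral => //.
  - by move=> x _; rewrite lee_fin sqr_ge0.
  - apply: measurable_normc2; apply: cmeasurableD => //.
    by apply: cmeasurableM => //; exact: cmeasurable_cst.
  - by apply: emeasurable_funD; apply: measurable_funeM.
  - move=> x _; rewrite -!EFinM -EFinD lee_fin.
    have := ler_normcD (a * f x) (g x); rewrite normcM => le1.
    have sq := sqr_ge0 (normc a * normc (f x) - normc (g x)).
    have le2 : normc (a * f x + g x) ^+ 2 <= (normc a * normc (f x) + normc (g x)) ^+ 2.
      by rewrite ler_sqr ?nnegrE ?addr_ge0 ?mulr_ge0 ?normc_ge0.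
    by apply: (le_trans le2); lra.
have a0 : 0 <= 2 * normc a ^+ 2 by rewrite mulr_ge0// sqr_ge0.
rewrite ge0_integralD//=.
- rewrite ge0_integralZl//= ge0_integralZl//= lte_add_pinfty//.
    by rewrite lte_mul_pinfty.
  by rewrite lte_mul_pinfty.
- by move=> x _; rewrite mule_ge0// lee_fin.
- by apply: measurable_funeM.
- by move=> x _; rewrite mule_ge0// lee_fin.
- by apply: measurable_funeM.
Qed.

End complex_functions.

Section hermite_series.
Context dT (T : measurableType dT) (R : realType) (P : probability T R).
Variables (X : T -> R) (a : R).
Hypothesis mX : measurable_fun setT X.
Hypothesis charX : forall t, Rintegral P setT (fun x => cos (t * X x)) = expR (- a * t
    ^+ 2).

Lemma cmeasurable_real : cmeasurable (fun x => (X x)%:C).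
Proof. by split => //=; exact: measurable_cst. Qed.

Lemma cexp_imag (t y : R) :
  cexp ('i%C * (t%:C * y%:C)) = (cos (t * y) +i* sin (t * y))%C.
Proof.
rewrite -rmorphM/= /cexp.
have -> : 'i%C * (t * y)%:C = (0 +i* (t * y))%C.
  by apply: complex_eq => /=; ring.
by rewrite /= expR0 !mul1r.
Qed.

Lemma cmeasurable_cexp_imag (t : R) :
  cmeasurable (fun x => cexp ('i%C * (t%:C * (X x)%:C))).
Proof.
have mtX : measurable_fun setT (fun x => t * X x).
  by apply: measurable_funM => //; exact: measurable_cst.
split; under eq_fun do rewrite cexp_imag/=.
  apply: (measurableT_comp (f := @cos R)) => //.
  by apply: continuous_measurable_fun; exact: continuous_cos.
apply: (measurableT_comp (f := @sin R)) => //.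
by apply: continuous_measurable_fun; exact: continuous_sin.
Qed.

Lemma cmeasurable_hermite n : cmeasurable (fun x => hermite a%:C n (X x)%:C).
Proof.
rewrite /hermite /conv /cexp_coeff.
apply: cmeasurable_sum => i; apply: cmeasurableM; last exact: cmeasurable_cst.
apply: cmeasurableM; last exact: cmeasurable_cst.
by apply: cmeasurableX; exact: cmeasurable_real.
Qed.

Definition hermite_bound (s : R) x := expR (s * `|X x| + s ^+ 2 * `|a|).

Lemma sum_hermite_le (s : R) x N : 0 <= s ->
  \sum_(n < N) normc (hermite a%:C n (X x)%:C) * s ^+ n <= hermite_bound s x.
Proof.
by move=> s0; have := sum_normc_hermite_le a%:C (X x)%:C N s0; rewrite !normc_real.
Qed.

Lemma measurable_hermite_bound (s : R) : measurable_fun setT (hermite_bound s).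
Proof.
apply: (measurableT_comp (f := @expR R)) => //; apply: measurable_funD => //.
by apply: measurable_funM => //; exact: measurableT_comp.
Qed.

(** Squaring doubles the rate [s], which is harmless since exponential moments of all rates are
    finite. *)
Lemma hermite_bound2_lty (M s : R) :
  (\int[P]_x ((M * hermite_bound s x) ^+ 2)%:E < +oo)%E.
Proof.
have E x : ((M * hermite_bound s x) ^+ 2)%:E =
    ((M ^+ 2 * expR (2 * (s ^+ 2 * `|a|)))%:E * (expR (2 * s * `|X x|))%:E)%E.
  rewrite -EFinM; congr (_%:E).
  rewrite /hermite_bound exprMn -expRM_natl -[RHS]mulrA -expRD.
  by congr (_ * expR _); ring.
under eq_integral do rewrite E.
have c0 : 0 <= M ^+ 2 * expR (2 * (s ^+ 2 * `|a|)) by rewrite mulr_ge0 ?sqr_ge0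
    ?expR_ge0.
rewrite ge0_integralZl//=.
- by rewrite lte_mul_pinfty//; exact: (gaussian_exp_moment mX charX).
- apply/measurable_EFinP; apply: (measurableT_comp (f := @expR R)) => //.
  by apply: measurable_funM => //; exact: measurableT_comp.
Qed.

Lemma normc2_integral_dominated (f : T -> R[i]) (M s : R) : cmeasurable f ->
  (forall x, normc (f x) <= M * hermite_bound s x) ->
  (\int[P]_x (normc (f x) ^+ 2)%:E < +oo)%E.
Proof.
move=> mf fM; apply: le_lt_trans (hermite_bound2_lty M s); apply: ge0_le_integral => //.
- by move=> x _; rewrite lee_fin sqr_ge0.
- exact: measurable_normc2.
- apply/measurable_EFinP; apply: measurable_funX; apply: measurable_funM => //.
  exact: measurable_hermite_bound.
- move=> x _; rewrite lee_fin ler_sqr ?nnegrE ?normc_ge0//.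
  exact: le_trans (normc_ge0 _) (fM x).
Qed.

Lemma hermite_normc2_integral n :
  (\int[P]_x (normc (hermite a%:C n (X x)%:C) ^+ 2)%:E < +oo)%E.
Proof.
apply: (@normc2_integral_dominated _ 1 1); first exact: cmeasurable_hermite.
move=> x; rewrite mul1r (le_trans _ (sum_hermite_le x n.+1 ler01))//.
rewrite big_ord_recr/= expr1n mulr1 lerDr.
by apply: sumr_ge0 => i _; rewrite mulr_ge0 ?normc_ge0 ?exprn_ge0.
Qed.

(* Absolute convergence of the Hermite series turns pointwise convergence into
   L2 convergence, by domination. *)
Lemma hermite_series_L2 (f : T -> R[i]) (b : nat -> R[i]) (M s : R) : 0 <= s ->
  (forall n, normc (b n) <= M * s ^+ n) -> cmeasurable f ->
  (forall x, ccvg (fun N => \sum_(n < N) b n * hermite a%:C n (X x)%:C) (f x)) ->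
  (\int[P]_x (normc (f x) ^+ 2)%:E < +oo)%E /\
  (fun N => (\int[P]_x
    (normc ((\sum_(n < N) b n * hermite a%:C n (X x)%:C) - f x)%R ^+ 2)%:E)%E)
    @ \oo --> 0%E.
Proof.
move=> s0 bM mf bf.
have M0 : 0 <= M by have := bM 0%N; rewrite expr0 mulr1; exact: le_trans (normc_ge0 _).
have S_le x N : normc (\sum_(n < N) b n * hermite a%:C n (X x)%:C) <= M * hermite_bound
    s x.
  rewrite (le_trans (ler_normc_sum _ _ _))//.
  apply: le_trans (ler_wpM2l M0 (sum_hermite_le x N s0)).
  rewrite mulr_sumr; apply: ler_sum => n _; rewrite normcM.
  by rewrite [normc (hermite _ _ _) * _]mulrC mulrA ler_wpM2r ?normc_ge0.
have f_le x : normc (f x) <= M * hermite_bound s x.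
  apply/ler_addgt0Pl => e e0;
      have /cvgr0Pnorm_lt/(_ _ e0)[N _ /(_ N (leqnn _))] := bf x.
  rewrite /= ger0_norm ?normc_ge0// => lt.
  rewrite -[f x](subrK (\sum_(n < N) b n * hermite a%:C n (X x)%:C)).
  by rewrite (le_trans (ler_normcD _ _))// lerD// normcB ltW.
split; first exact: normc2_integral_dominated f_le.
pose u N x := normc (\sum_(n < N) b n * hermite a%:C n (X x)%:C - f x) ^+ 2.
have mu_ N : measurable_fun setT (fun x => (u N x)%:E).
  apply: measurable_normc2; apply: cmeasurableB => //.
  apply: cmeasurable_sum => n; apply: cmeasurableM; first exact: cmeasurable_cst.
  exact: cmeasurable_hermite.
have u0 : {ae P, forall x, setT x -> (fun N => (u N x)%:E) @ \oo --> 0%E}.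
  apply: aeW => {}x _; apply: cvg_EFin; first by near=> N.
  suff : (fun N => u N x) @ \oo --> 0 by [].
  have -> : (fun N => u N x) = (fun N =>
      normc (\sum_(n < N) b n * hermite a%:C n (X x)%:C - f x) *
      normc (\sum_(n < N) b n * hermite a%:C n (X x)%:C - f x)).
    by apply/funext => N; rewrite /u expr2.
  by rewrite -[X in _ --> X](mulr0 0); apply: cvgM; exact: bf.
(* The factor 2: the partial sum and the limit are each at most [M * hermite_bound s x]. *)
have intD : P.-integrable setT (fun x => ((2 * M * hermite_bound s x) ^+ 2)%:E).
  apply/integrableP; split.
    apply/measurable_EFinP; apply: measurable_funX; apply: measurable_funM => //.
    exact: measurable_hermite_bound.
  under eq_integral do rewrite abse_EFin ger0_norm ?sqr_ge0//.
  exact: hermite_bound2_lty.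
have dom : {ae P, forall x N, setT x -> (`|(u N x)%:E| <= ((2 * M * hermite_bound s x)
    ^+ 2)%:E)%E}.
  apply: aeW => x N _; rewrite abse_EFin ger0_norm ?sqr_ge0// lee_fin.
  rewrite /u ler_sqr ?nnegrE ?normc_ge0 ?mulr_ge0 ?expR_ge0//.
  by rewrite (le_trans (ler_normcD _ _))// normcN -mulrA mulr_natl mulr2n lerD.
have [_ _ +] := @dominated_convergence _ _ _ P setT measurableT (fun N x => (u N x)%:E)
  (cst 0%E) _ mu_ (measurable_cst _) u0 intD dom.
by rewrite integral_cst// mul0e.
Unshelve. all: by end_near. Qed.

End hermite_series.

(** * Chaos decompositions along a ray *)

Section hida.
Variables (R : realType) (d : nat) (mu : probability (Omega R d) R).
Variable W : forall n, Mdual R d -> tensor R d n.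
Hypothesis Hmu : standard_gaussian mu.
Hypothesis HW : wick_monomials W.

Section one_direction.
Variable F : Mdual R d.
Hypothesis finF : Mfin F.

Let X (A : Omega R d) : R := complex.Re (pairing A F).
Let a : R := complex.Re (pairing F F) / 2.

Let pairingE A : pairing A F = (X A)%:C.
Proof. exact: pairing_real. Qed.

Let half_norm2E : pairing F F / 2 = a%:C.
Proof.
rewrite /a rmorphM/= -pairing_real// fmorphV/=; congr (_ / _).
by rewrite raddfMn.
Qed.

Lemma measurable_pairing : measurable_fun setT X.
Proof.
move=> _ Y mY; rewrite setTI; apply: sub_sigma_algebra.
by exists F, Y.
Qed.

Lemma cexp_hscale (t : R) A :
  cexp ('i%C * pairing A (hscale t F)) = cexp ('i%C * (t%:C * (X A)%:C)).
Proof. by rewrite pairing_hscaler pairingE. Qed.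

Lemma gaussian_char (t : R) :
  Rintegral mu setT (fun A => cos (t * X A)) = expR (- a * t ^+ 2).
Proof.
have := Hmu (Mfin_hscale t finF).
rewrite pairing_hscaler pairing_hscalel => /(congr1 (@complex.Re R)).
rewrite -[complex.Re (cintegral _ _)]/(Rintegral mu setT
  (fun A => complex.Re (cexp ('i%C * pairing A (hscale t F))))).
rewrite (@eq_Rintegral _ _ _ _ _ (fun A => cos (t * X A))) => [->|A _]; last first.
  by rewrite cexp_hscale cexp_imag.
have -> : - (t%:C * (t%:C * pairing F F) / 2) = (- a * t ^+ 2)%:C.
  by rewrite -!mulrA half_norm2E -!rmorphM -rmorphN; congr (_%:C); ring.
by rewrite /= cos0 mulr1.
Qed.

(* The generating function determines the Wick powers along F. *)
Lemma tpairing_wick n A :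
  tpairing (@W n A) (tpow n F) = n`!%:R * hermite a%:C n (X A)%:C.
Proof.
have f0 : (n`!%:R : R[i]) != 0 by rewrite pnatr_eq0 -lt0n fact_gt0.
apply: (mulfI (invr_neq0 f0)); rewrite mulKf//.
apply: (@cpower_series_inj _ (fun n => (n`!%:R)^-1 * tpairing (@W n A) (tpow n F))
  (fun n => hermite a%:C n (X A)%:C)
  (fun t => cexp (t%:C * (X A)%:C - a%:C * t%:C ^+ 2))) => t; last exact: ccvg_hermite.
have := HW.2 A _ (Mfin_hscale t finF).
rewrite pairing_hscaler pairing_hscaler pairing_hscalel pairingE.
have -> : t%:C * (t%:C * pairing F F) / 2 = a%:C * t%:C ^+ 2.
  by rewrite -!mulrA half_norm2E; ring.
congr (ccvg _ _); apply/funext => N; apply: eq_bigr => k _.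
rewrite -mulrA; congr (_ * _).
rewrite (_ : tpow k (hscale t F) = fun x => t%:C ^+ k * tpow k F x).
  by rewrite tpairingZ mulrC.
by apply/funext => x; exact: tpow_hscale.
Qed.

(** The chaos kernels of the function with Hermite coefficients [b] along [F]; the division by [n!]
    compensates the factor in [tpairing_wick]. *)
Definition ray_kernel (b : nat -> R[i]) n : tensor R d n :=
  fun x => b n / n`!%:R * tpow n F x.

Lemma tpairing_ray b n A :
  tpairing (@W n A) (ray_kernel b (n := n)) = b n * hermite a%:C n (X A)%:C.
Proof.
rewrite tpairingZ tpairing_wick; have : (n`!%:R : R[i]) != 0.
  by rewrite pnatr_eq0 -lt0n fact_gt0.
by move=> f0; field.
Qed.

Lemma ray_supported K b n : herm_bounded K F -> box_supported K (ray_kernel b (n := n)).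
Proof.
move=> bF x bx; apply: (tpow_supported bF); apply: contra bx => /eqP tx.
by rewrite /ray_kernel tx mulr0.
Qed.

Lemma ray_symmetric b n : symmetric_tensor (ray_kernel b (n := n)).
Proof. by move=> s x; rewrite /ray_kernel tpow_symmetric. Qed.

Lemma L2_hermite n : L2 mu (fun A => hermite a%:C n (X A)%:C).
Proof.
have [mR mI] := @cmeasurable_hermite _ _ _ _ a measurable_pairing n.
by split=> //; exact: (hermite_normc2_integral measurable_pairing gaussian_char).
Qed.

Lemma L2_scale (z : R[i]) f : L2 mu f -> L2 mu (fun A => z * f A).
Proof.
move=> [mR mI f2].
have m0 := @cmeasurable_cst _ (Omega R d) R 0.
have mzf : cmeasurable (fun A : Omega R d => z * f A + 0).
  by apply: cmeasurableD => //; apply: cmeasurableM => //; exact: cmeasurable_cst.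
rewrite (_ : (fun A => _) = fun A => z * f A + 0); last by apply/funext => A;
    rewrite addr0.
have [mR' mI'] := mzf; split=> //.
apply: normc2_integral_lin => //.
under eq_integral do rewrite normc0 expr0n.
by rewrite integral0.
Qed.

(** As [F] has finite support, the truncations of each kernel are eventually the kernel itself, so
    every Wick integral is an honest finite sum. Only the sum over [n] needs an L2 limit, supplied
    by [hermite_series_L2]. *)
Lemma chaos_ray (f : Mdual R d -> R[i]) (b : nat -> R[i]) (M s : R) : 0 <= s ->
  (forall n, normc (b n) <= M * s ^+ n) -> cmeasurable (f : Omega R d -> R[i]) ->
  (forall A, ccvg (fun N => \sum_(n < N) b n * hermite a%:C n (X A)%:C) (f A)) ->
  chaos mu W f (ray_kernel b).
Proof.
move=> s0 bM mf bf.
have [f2 bf2] := hermite_series_L2 measurable_pairing gaussian_char s0 bM mf bf.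
have [K bK] := Mfin_bounded finF.
split; first by case: mf.
  move=> n; split; first exact: ray_symmetric.
  rewrite (tnorm2_box _ (@ray_supported K b n bK)) ?ltry// => i j; exact: ler01.
exists (fun n A => b n * hermite a%:C n (X A)%:C); split=> [n|]; last exact: bf2.
split; first by apply: L2_scale; exact: L2_hermite.
apply: cvg_near_cst; exists K => // k /= Kk.
apply: integral0_eq => A _.
by rewrite (truncate_supported (@ray_supported K b n bK) Kk) tpairing_ray subrr normc0
    expr0n.
Qed.

(** The kernels carry [1 / n!], squared in the norm, against a single [n!] in the weight; the
    remaining [1 / n!] beats every geometric factor. [B] is fixed before [b], [M] and [s], so that
    it serves all tails of a series at once. *)
Lemma fock_norm2_ray (p : nat -> nat -> R) (q : nat) : weight p ->
  exists2 B : R, 0 <= B & forall (b : nat -> R[i]) (M s : R), 0 <= s ->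
    (forall n, normc (b n) <= M * s ^+ n) ->
    (fock_norm2 p q (ray_kernel b) <= (M ^+ 2 * expR (2 ^+ q * s ^+ 2 * B))%:E)%E.
Proof.
move=> [_ p1]; have p0 i j : 0 <= p i j by exact: le_trans ler01 (p1 i j).
have [B B0 hB] := tnorm2_tpow p0 finF; exists B => // b M s s0 bM.
have t0 n : (0 <= ((n`! * 2 ^ (n * q))%N%:R)%:E * tnorm2 p (ray_kernel b (n := n)))%E.
  apply: mule_ge0; first by rewrite lee_fin.
  by apply: esum_ge0 => x _; rewrite lee_fin mulr_ge0 ?sqr_ge0 ?prodr_ge0.
apply: lime_le; first by apply: is_cvg_nneseries.
near=> N.
apply: (@le_trans _ _ (\sum_(0 <= n < N) (M ^+ 2 * ((2 ^+ q * s ^+ 2 * B) ^+ n /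
    n`!%:R))%:E)%E).
  apply: lee_sum => n _; apply: le_trans.
    by apply: lee_wpmul2l; [rewrite lee_fin|exact: hB].
  rewrite -EFinM lee_fin normcM normcV normc_nat.
  have f0 : (0 : R) < n`!%:R by rewrite ltr0n fact_gt0.
  have -> : M ^+ 2 * ((2 ^+ q * s ^+ 2 * B) ^+ n / n`!%:R) =
      (n`! * 2 ^ (n * q))%:R * (((M * s ^+ n) / n`!%:R) ^+ 2 * B ^+ n).
    rewrite natrM natrX [(n * q)%N]mulnC exprM !exprMn.
    by field; rewrite gt_eqF.
  rewrite ler_wpM2l// ler_wpM2r ?exprn_ge0//.
  rewrite ler_sqr ?nnegrE ?divr_ge0 ?normc_ge0//;
      last exact: le_trans (normc_ge0 _) (bM n).
  by rewrite ler_wpM2r ?invr_ge0.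
rewrite sumEFin lee_fin big_mkord -mulr_sumr ler_wpM2l ?sqr_ge0//.
by apply: sum_expR_le; rewrite !mulr_ge0 ?sqr_ge0 ?exprn_ge0.
Unshelve. all: by end_near. Qed.

(** The norm is an infimum over decompositions, so exhibiting one bounds it. *)
Lemma hida_norm2_ray (f : Mdual R d -> R[i]) (p : nat -> nat -> R) (q : nat)
    (b : nat -> R[i]) : chaos mu W f (ray_kernel b) ->
  (hida_norm2 mu W p q f <= fock_norm2 p q (ray_kernel b))%E.
Proof. by move=> ch; apply: ereal_inf_lbound; exists (ray_kernel b). Qed.

Lemma test_function_ray (f : Mdual R d -> R[i]) (b : nat -> R[i]) (M s : R) : 0 <= s ->
  (forall n, normc (b n) <= M * s ^+ n) -> cmeasurable (f : Omega R d -> R[i]) ->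
  (forall A, ccvg (fun N => \sum_(n < N) b n * hermite a%:C n (X A)%:C) (f A)) ->
  test_function mu W f.
Proof.
move=> s0 bM mf bf p q wp; have [B _ hB] := fock_norm2_ray q wp.
apply: le_lt_trans (hida_norm2_ray _ _ (chaos_ray s0 bM mf bf)) _.
by apply: le_lt_trans (hB _ _ _ s0 bM) _; exact: ltry.
Qed.

End one_direction.
End hida.

(** * Hida distributions *)

Section wick_polynomials.
Variables (R : realType) (d : nat) (mu : probability (Omega R d) R).
Variable W : forall n, Mdual R d -> tensor R d n.
Hypothesis Hmu : standard_gaussian mu.
Hypothesis HW : wick_monomials W.
Implicit Types f g : Mdual R d -> R[i].

Lemma L2_lin f g (z : R[i]) : L2 mu f -> L2 mu g -> L2 mu (fun A => z * f A + g A).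
Proof.
move=> [rf imf f2] [rg img g2].
have mf : cmeasurable (f : Omega R d -> R[i]) by [].
have mg : cmeasurable (g : Omega R d -> R[i]) by [].
have [mR mI] : cmeasurable (fun A : Omega R d => z * f A + g A).
  by apply: cmeasurableD => //; apply: cmeasurableM => //; exact: cmeasurable_cst.
by split=> //; exact: normc2_integral_lin.
Qed.

Lemma L2_zero : L2 mu (fun=> 0).
Proof.
split; [exact: measurable_cst|exact: measurable_cst|].
under eq_integral do rewrite normc0 expr0n.
by rewrite integral0.
Qed.

(** Unlike functions on a ray, these are closed under linear combinations. Square integrability is a
    clause of the definition: it is established along rays and propagates by linearity. *)
Definition wick_polynomial f := exists (k : forall n, tensor R d n) (N K : nat),
  [/\ forall n, symmetric_tensor (@k n), forall n, box_supported K (@k n),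
      forall n, (N <= n)%N -> @k n = fun=> 0,
      forall n, L2 mu (fun A => tpairing (@W n A) (@k n)) &
      forall A, f A = \sum_(n < N) tpairing (@W n A) (@k n)].

Lemma tpairing0 n (u : tensor R d n) : tpairing u (fun=> 0) = 0.
Proof. by rewrite /tpairing fsbig1// => x _; rewrite mulr0. Qed.

Lemma sum_eventually0 (V : nmodType) (h : nat -> V) N N' : (N <= N')%N ->
  (forall n, (N <= n)%N -> h n = 0) -> \sum_(n < N') h n = \sum_(n < N) h n.
Proof.
move=> NN h0; rewrite -!(big_mkord xpredT) (@big_cat_nat _ _ _ N)//= [X in _ +
    X]big_nat_cond.
by rewrite [X in _ + X]big1 ?addr0// => n /andP[/andP[/h0]].
Qed.

(** All limits in the definition of a test function are eventually constant here. *)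
Lemma wick_polynomial_test f : wick_polynomial f -> test_function mu W f.
Proof.
move=> [k [N [K [ksym kK kN kL2 fE]]]] p q [_ p1].
have p0 i j : 0 <= p i j by exact: le_trans ler01 (p1 i j).
have tw n A : (N <= n)%N -> tpairing (@W n A) (@k n) = 0 by move=> /kN ->;
    exact: tpairing0.
have ch : chaos mu W f k.
  split.
  - rewrite (_ : f = fun A => \sum_(n < N) tpairing (@W n A) (@k n)); last exact/funext.
    elim: N {kN fE tw} => [|N IH].
      by rewrite (_ : (fun A => _) = fun=> 0); [exact: L2_zero|apply/funext => A;
          rewrite big_ord0].
    rewrite (_ : (fun A => _) = fun A => 1 * tpairing (@W N A) (@k N) +
        \sum_(n < N) tpairing (@W n A) (@k n)); first exact: L2_lin.
    by apply/funext => A; rewrite big_ord_recr/= mul1r addrC.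
  - by move=> n; split=> //; rewrite (tnorm2_box _ (kK n)) ?ltry// => i j; exact: ler01.
  - exists (fun n A => tpairing (@W n A) (@k n)); split=> [n|].
      split=> //; apply: cvg_near_cst; exists K => // K' /= KK;
          apply: integral0_eq => A _.
      by rewrite (truncate_supported (kK n) KK) subrr normc0 expr0n.
    apply: cvg_near_cst; exists N => // N' /= NN; apply: integral0_eq => A _.
    rewrite (@sum_eventually0 _ (fun n => tpairing (@W n A) (@k n)) _ _ NN) => [|n Nn].
      by rewrite fE subrr normc0 expr0n.
    exact: tw.
apply: le_lt_trans; first by apply: ereal_inf_lbound; exists k; [exact: ch|reflexivity].
pose r n := (n`! * 2 ^ (n * q))%N%:R * fine (tnorm2 p (@k n)).
have tE n : tnorm2 p (@k n) = (fine (tnorm2 p (@k n)))%:E.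
  by rewrite (tnorm2_box p0 (kK n)).
have t0 n : 0 <= fine (tnorm2 p (@k n)).
  by rewrite -lee_fin -tE; apply: esum_ge0 => x _;
      rewrite lee_fin mulr_ge0 ?sqr_ge0 ?prodr_ge0.
apply: (@le_lt_trans _ _ (\sum_(n < N) r n)%:E); last exact: ltry.
apply: lime_le.
  apply: is_cvg_nneseries => n _ _; rewrite tE -EFinM lee_fin.
  by rewrite mulr_ge0.
exists N => // N' /= NN; rewrite big_mkord.
under [X in (X <= _)%E]eq_bigr do rewrite tE -EFinM.
rewrite sumEFin lee_fin (@sum_eventually0 _ r _ _ NN)// => n /kN kn; rewrite /r.
have -> : tnorm2 p (@k n) = 0%E.
  by apply: esum1 => x _; rewrite kn normc0 expr0n mulr0.
by rewrite mulr0.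
Qed.

Lemma wick_polynomial0 : wick_polynomial (fun=> 0).
Proof.
exists (fun n _ => 0), 0%N, 0%N; split=> //.
- by move=> n x; rewrite eqxx.
- move=> n; rewrite (_ : (fun A => _) = fun=> 0); first exact: L2_zero.
  by apply/funext => A; exact: tpairing0.
- by move=> A; rewrite big_ord0.
Qed.

Lemma wick_polynomial_lin f g (z : R[i]) :
  wick_polynomial f -> wick_polynomial g -> wick_polynomial (fun A => z * f A + g A).
Proof.
move=> [k [N [K [ksym kK kN kL2 fE]]]] [l [N' [K' [lsym lK lN lL2 gE]]]].
have kK2 n : box_supported (maxn K K') (@k n) by exact: box_supported_le (leq_maxl _ _)
    (kK n).
have lK2 n : box_supported (maxn K K') (@l n) by exact: box_supported_le (leq_maxr _ _)
    (lK n).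
have lin n A : tpairing (@W n A) (fun x => z * @k n x + @l n x) =
    z * tpairing (@W n A) (@k n) + tpairing (@W n A) (@l n) by exact: (@tpairing_lin _
        _ _ (maxn K K')).
exists (fun n x => z * @k n x + @l n x), (maxn N N'), (maxn K K'); split.
- by move=> n s x; rewrite ksym lsym.
- move=> n x; apply: contraR => nx;
    have z0 (h : tensor R d n) : box_supported (maxn K K') h -> h x = 0.
    by move=> bh; apply/eqP; apply: contraR nx => /bh.
  by rewrite (z0 _ (kK2 n)) (z0 _ (lK2 n)) mulr0 addr0.
- by move=> n; rewrite geq_max => /andP[/kN -> /lN ->]; apply/funext => x;
    rewrite mulr0 addr0.
- by move=> n; under eq_fun do rewrite lin; exact: L2_lin.
- move=> A; under eq_bigr do rewrite lin.
  rewrite big_split/= -mulr_sumr fE gE.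
  rewrite -(@sum_eventually0 _ (fun n => tpairing (@W n A) (@k n)) _ _ (leq_maxl N N'))
      => [|n /kN ->]; last exact: tpairing0.
  by rewrite -(@sum_eventually0 _ (fun n => tpairing (@W n A) (@l n)) _ _ (leq_maxr N
      N'))// => n /lN ->; exact: tpairing0.
Qed.

Lemma wick_polynomial_sum (I : Type) (r : seq I) (c : I -> R[i]) (f : I -> Mdual R d ->
    R[i]) :
  (forall i, wick_polynomial (f i)) ->
  wick_polynomial (fun A => \sum_(i <- r) c i * f i A).
Proof.
move=> wf; elim: r => [|i r IH].
  by rewrite (_ : (fun A => _) = fun=> 0); [exact: wick_polynomial0|apply/funext => A;
      rewrite big_nil].
rewrite (_ : (fun A => _) = fun A => c i * f i A + \sum_(j <- r) c j * f j A).
  exact: wick_polynomial_lin.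
by apply/funext => A; rewrite big_cons.
Qed.

Definition hermite_field (F : Mdual R d) n (A : Mdual R d) : R[i] :=
  hermite (complex.Re (pairing F F) / 2)%:C n (complex.Re (pairing A F))%:C.

Lemma wick_polynomial_hermite F n : Mfin F -> wick_polynomial (hermite_field F n).
Proof.
move=> finF; have [K bK] := Mfin_bounded finF.
pose b j : R[i] := (j == n)%:R.
exists (@ray_kernel R d F b), n.+1, K; split.
- by move=> j; exact: ray_symmetric.
- by move=> j; exact: ray_supported.
- move=> j nj; apply/funext => x; rewrite /ray_kernel /b gtn_eqF// !mul0r //.
- move=> j; under eq_fun do rewrite tpairing_ray//.
  by apply: L2_scale; exact: L2_hermite.
- move=> A; under eq_bigr do rewrite tpairing_ray//.
  rewrite big_ord_recr/= big1 ?add0r => [|j _]; first by rewrite /b eqxx mul1r.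
  by rewrite /b ltn_eqF ?mul0r.
Qed.

Lemma power_hermite F n A : Mfin F -> pairing A F ^+ n =
  \sum_(j < n.+1) (n`!%:R * gauss_coeff (complex.Re (pairing F F) / 2)%:C (n - j)) *
    hermite_field F j A.
Proof.
move=> finF; have f0 : (n`!%:R : R[i]) != 0 by rewrite pnatr_eq0 -lt0n fact_gt0.
have : n`!%:R * cexp_coeff (pairing A F) n = pairing A F ^+ n by rewrite /cexp_coeff
    mulrC divfK.
move=> <-; rewrite (pairing_real A finF).
rewrite -(hermite_inv (complex.Re (pairing F F) / 2)%:C) /conv mulr_sumr.
by apply: eq_bigr => j _; rewrite -mulrA [gauss_coeff _ _ * _]mulrC.
Qed.

Lemma wick_polynomial_power F n : Mfin F -> wick_polynomial (fun A => pairing A F ^+ n).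
Proof.
move=> finF; rewrite (_ : (fun A => _) = fun A => \sum_(j < n.+1)
   (n`!%:R * gauss_coeff (complex.Re (pairing F F) / 2)%:C (n - j)) * hermite_field F j
       A).
  by apply: wick_polynomial_sum => j; exact: wick_polynomial_hermite.
by apply/funext => A; exact: power_hermite.
Qed.

Definition subset_sum (T : finType) (F : T -> Mdual R d) (S : {set T}) : Mdual R d :=
  lincomb (fun k => (k \in S)%:R) F.

Lemma pairing_subset_sum (T : finType) (F : T -> Mdual R d) (S : {set T}) A :
  (forall k, Mfin (F k)) -> pairing A (subset_sum F S) = \sum_(k in S) pairing A (F k).
Proof.
move=> finF; rewrite pairing_lincomb// [RHS]big_mkcond; apply: eq_bigr => k _.
by case: ifP => _; rewrite ?mul1r ?mul0r.
Qed.

Lemma Mfin_subset_sum (T : finType) (F : T -> Mdual R d) (S : {set T}) :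
  (forall k, Mfin (F k)) -> Mfin (subset_sum F S).
Proof. exact: Mfin_lincomb. Qed.

Lemma prod_pairing_polarization (T : finType) (F : T -> Mdual R d) A :
  (forall k, Mfin (F k)) ->
  \prod_k pairing A (F k) = \sum_(S : {set T}) (((#|T|)`!%:R)^-1 * (-1) ^+ #|~: S|) *
    pairing A (subset_sum F S) ^+ #|T|.
Proof.
move=> finF; have f0 : ((#|T|)`!%:R : R[i]) != 0 by rewrite pnatr_eq0 -lt0n fact_gt0.
apply: (mulfI f0); rewrite -prod_polarization mulr_sumr; apply: eq_bigr => S _.
by rewrite pairing_subset_sum// !mulrA mulfV// mul1r.
Qed.

Lemma wick_polynomial_prod (T : finType) (F : T -> Mdual R d) :
  (forall k, Mfin (F k)) -> wick_polynomial (fun A => \prod_k pairing A (F k)).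
Proof.
move=> finF; rewrite (_ : (fun A => _) = fun A => \sum_(S : {set T})
    (((#|T|)`!%:R)^-1 * (-1) ^+ #|~: S|) * pairing A (subset_sum F S) ^+ #|T|).
  apply: wick_polynomial_sum => S; apply: wick_polynomial_power.
  exact: Mfin_subset_sum.
by apply/funext => A; exact: prod_pairing_polarization.
Qed.

(** * Moments of the distribution *)

Section distribution.
Variable Phi : (Mdual R d -> R[i]) -> R[i].
Hypothesis HPhi : hida_distribution mu W Phi.

Lemma Phi_sum (I : Type) (r : seq I) (c : I -> R[i]) (f : I -> Mdual R d -> R[i]) :
  (forall i, wick_polynomial (f i)) ->
  Phi (fun A => \sum_(i <- r) c i * f i A) = \sum_(i <- r) c i * Phi (f i).
Proof.
move=> wf; elim: r => [|i r IH].
  have t0 := wick_polynomial_test wick_polynomial0.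
  (* [Phi 0 = 0] has to be extracted from [Phi (1 * 0 + 0) = Phi 0 + Phi 0]. *)
  have := HPhi.1 1 _ _ t0 t0; rewrite mulr0 addr0 mul1r => /eqP.
  rewrite -subr_eq0 opprD addNKr oppr_eq0 => /eqP P0.
  rewrite big_nil -[RHS]P0; congr Phi; apply/funext => A; exact: big_nil.
rewrite big_cons -IH -HPhi.1.
- by congr Phi; apply/funext => A; rewrite big_cons.
- exact: wick_polynomial_test.
- by apply: wick_polynomial_test; exact: wick_polynomial_sum.
Qed.

Let tau (F : Mdual R d) : R[i] :=
  \sum_(nu < d) mattr (matmul (F (inl nu)) (F (inr nu))).

Hypothesis HT : forall F : Mdual R d, Mfin F ->
  T_transform Phi F = cexp (- ('i%C * tau F)).

Section one_direction.
Variable F : Mdual R d.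
Hypothesis finF : Mfin F.
Let a : R := complex.Re (pairing F F) / 2.
Let X (A : Omega R d) : R := complex.Re (pairing A F).

(** The exponential [e] is the sum of a Hermite series with partial sums [S N]. Continuity of [Phi]
    at [e] allows summation under [Phi], and [Phi e] is the T-transform at [t F]. *)
Lemma ccvg_Phi_hermite (t : R) :
  ccvg (fun N => \sum_(n < N) ('i%C ^+ n * Phi (hermite_field F n)) * t%:C ^+ n)
    (cexp ((a%:C - 'i%C * tau F) * t%:C ^+ 2)).
Proof.
pose e (A : Mdual R d) := cexp ('i%C * pairing A (hscale t F)).
(* At [z = i t] the generating function is [exp(i t x + a t^2)]; [z0] removes the second term. *)
pose z0 : R[i] := cexp (- (a%:C * t%:C ^+ 2)).
pose c n : R[i] := z0 * ('i%C * t%:C) ^+ n.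
pose S N (A : Mdual R d) := \sum_(n < N) c n * hermite_field F n A.
have it : normc ('i%C * t%:C) = `|t|.
  by rewrite normcM normc_real /= expr0n expr1n add0r sqrtr1 mul1r.
have me : cmeasurable (e : Omega R d -> R[i]).
  rewrite (_ : e = fun A : Omega R d => cexp ('i%C * (t%:C * (X A)%:C))).
    exact: cmeasurable_cexp_imag (measurable_pairing finF) _.
  by apply/funext => A; exact: cexp_hscale.
have Se A : ccvg (fun N => S N A) (e A).
  have := ccvgM (ccvg_cst z0) (ccvg_hermite a%:C (X A)%:C ('i%C * t%:C)).
  have -> : z0 * cexp ('i%C * t%:C * (X A)%:C - a%:C * ('i%C * t%:C) ^+ 2) = e A.
    rewrite /z0 -cexpD /e cexp_hscale//; congr cexp.
    by rewrite exprMn sqr_i -/(X A); ring.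
  congr (ccvg _ _); apply/funext => N; rewrite /S mulr_sumr; apply: eq_bigr => n _.
  by rewrite /c /hermite_field -/a -/(X A) -mulrA [_ ^+ n * _]mulrC.
have c_le n : normc (c n) <= normc z0 * `|t| ^+ n by rewrite normcM normcX it.
have te : test_function mu W e by exact: test_function_ray (normr_ge0 t) c_le me Se.
have tS N : test_function mu W (S N).
  apply: wick_polynomial_test; apply: wick_polynomial_sum => n.
  exact: wick_polynomial_hermite.
have PS : ccvg (fun N => Phi (S N)) (Phi e).
  apply/cvgr0Pnorm_lt => eps eps0.
  have [p [q [dlt [wp dlt0 hPhi]]]] := HPhi.2 e te eps eps0.
  have [B B0 hB] := fock_norm2_ray finF q wp.
  (* For [n >= N], [|t|^n <= 2^(- N) (2 |t|)^n]: doubling the rate buys a factor that tends to 0,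
     while the exponential in the norm estimate stays fixed. *)
  have lim0 : (fun N => (normc z0 * 2^-1 ^+ N) ^+ 2 *
      expR (2 ^+ q * (2 * `|t|) ^+ 2 * B)) @ \oo --> (0 : R).
    have h2 : (fun N => 2^-1 ^+ N : R) @ \oo --> (0 : R).
      by apply: cvg_expr; rewrite ger0_norm// invf_lt1// ltr1n.
    have hz : (fun N => normc z0 * 2^-1 ^+ N) @ \oo --> normc z0 * 0.
      by apply: cvgM => //; exact: cvg_cst.
    rewrite -(mul0r (expR (2 ^+ q * (2 * `|t|) ^+ 2 * B))).
    apply: cvgM; last exact: cvg_cst.
    under eq_fun do rewrite expr2.
    by rewrite -(mul0r 0) -{1 2}(mulr0 (normc z0)); apply: cvgM.
  have d2 : 0 < dlt ^+ 2 by rewrite exprn_gt0.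
  move/cvgr0Pnorm_lt : lim0 => /(_ _ d2); apply: filterS => N.
  rewrite ger0_norm; last by apply: mulr_ge0; [exact: sqr_ge0|exact: expR_ge0].
  move=> ltN.
  rewrite ger0_norm ?normc_ge0//; apply: hPhi => //.
  (* The Hermite coefficients of [S N - e]. *)
  pose b n : R[i] := if (n < N)%N then 0 else - c n.
  have b_le n : normc (b n) <= normc z0 * 2^-1 ^+ N * (2 * `|t|) ^+ n.
    rewrite /b; case: ltnP => [_|Nn].
      by rewrite normc0 !mulr_ge0 ?normc_ge0 ?exprn_ge0 ?mulr_ge0.
    rewrite normcN (le_trans (c_le n))// -mulrA ler_wpM2l ?normc_ge0//.
    rewrite exprMn mulrA ler_peMl ?exprn_ge0// exprVn mulrC ler_pdivlMr ?exprn_gt0//.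
    by rewrite mul1r ler_weXn2l// ler1n.
  have mSe : cmeasurable ((fun A => S N A - e A) : Omega R d -> R[i]).
    apply: cmeasurableB => //; apply: cmeasurable_sum => n; apply: cmeasurableM.
      exact: cmeasurable_cst.
    exact: cmeasurable_hermite (measurable_pairing finF) _.
  have bSe A : ccvg (fun M => \sum_(n < M) b n * hermite a%:C n (X A)%:C) (S N A - e A).
    have E M : (N <= M)%N -> \sum_(n < M) b n * hermite a%:C n (X A)%:C = S N A - S M A.
      move=> NM; rewrite -(big_mkord xpredT (fun n => b n * hermite a%:C n (X A)%:C)).
      rewrite /S -!(big_mkord xpredT (fun n => c n * hermite_field F n A)).
      rewrite (@big_cat_nat _ _ _ N 0 M)//= [in RHS](@big_cat_nat _ _ _ N 0 M)//=.
      rewrite opprD addrA subrr add0r -sumrN big_nat_cond big1 ?add0r => [|n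
          /andP[/andP[_ nN] _]].
        by apply: eq_big_nat => n /andP[Nn _]; rewrite /b ltnNge Nn/= mulNr.
      by rewrite /b nN mul0r.
    apply: cvg_trans (Se A); apply: near_eq_cvg; exists N => // M /= NM.
    rewrite E// normcB; congr normc; ring.
  apply: le_lt_trans (hida_norm2_ray _ _ (chaos_ray Hmu HW finF _ b_le mSe bSe)) _.
    by rewrite mulr_ge0.
  apply: le_lt_trans (hB _ _ _ _ b_le) _; first by rewrite mulr_ge0.
  by rewrite lte_fin.
have PSE N : Phi (S N) = z0 * \sum_(n < N) ('i%C ^+ n * Phi (hermite_field F n)) * t%:C
    ^+ n.
  rewrite Phi_sum => [|n]; last exact: wick_polynomial_hermite.
  rewrite mulr_sumr; apply: eq_bigr => n _; rewrite /c exprMn; ring.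
have PeE : Phi e = cexp (- ('i%C * (t%:C ^+ 2 * tau F))).
  rewrite -[LHS]/(T_transform Phi (hscale t F)) HT; last exact: Mfin_hscale.
  congr (cexp (- ('i%C * _))); rewrite /tau mulr_sumr; apply: eq_bigr => nu _.
  exact: mattr_matmul_hscale.
have := ccvgM (ccvg_cst (cexp (a%:C * t%:C ^+ 2))) PS.
rewrite PeE -cexpD.
have -> : a%:C * t%:C ^+ 2 - 'i%C * (t%:C ^+ 2 * tau F) = (a%:C - 'i%C * tau F) * t%:C
    ^+ 2 by ring.
congr (ccvg _ _); apply/funext => N.
by rewrite PSE mulrA [cexp _ * _]mulrC cexpNM mul1r.
Qed.

(** Multiplying by [(- i)^n] removes [i^n]; in [gauss_coeff] this is the substitution of [- i t] for
    [t], which changes the sign of the quadratic exponent. *)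
Lemma Phi_hermite n : Phi (hermite_field F n) = gauss_coeff ('i%C * tau F - a%:C) n.
Proof.
have E : 'i%C ^+ n * Phi (hermite_field F n) = gauss_coeff (a%:C - 'i%C * tau F) n.
  apply: (@cpower_series_inj _ (fun n => 'i%C ^+ n * Phi (hermite_field F n)) _
    (fun t => cexp ((a%:C - 'i%C * tau F) * t%:C ^+ 2))) => t;
        first exact: ccvg_Phi_hermite.
  under eq_fun do under eq_bigr do rewrite gauss_coeffZ.
  exact: ccvg_gauss_coeff.
have ii : (- 'i%C) * 'i%C = 1 :> R[i] by rewrite mulNr -expr2 sqr_i opprK.
rewrite -[LHS]mul1r -(expr1n _ n) -ii exprMn -mulrA E mulrC gauss_coeffZ sqrrN sqr_i.
by congr gauss_coeff; ring.
Qed.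

(** Returning from Hermite functions to powers convolves with [gauss_coeff a], which cancels the
    [- a] of [Phi_hermite]. *)
Lemma Phi_power n : Phi (fun A => pairing A F ^+ n) = n`!%:R * gauss_coeff ('i%C * tau
    F) n.
Proof.
under [X in Phi X]eq_fun do rewrite power_hermite//.
rewrite Phi_sum => [|j]; last exact: wick_polynomial_hermite.
under eq_bigr do rewrite Phi_hermite.
rewrite -[in RHS](subrK a%:C ('i%C * tau F)) -conv_gauss_coeff /conv [RHS]mulr_sumr.
by apply: eq_bigr => j _; rewrite -mulrA [gauss_coeff _ _ * _]mulrC.
Qed.

Lemma Phi_power_even m : Phi (fun A => pairing A F ^+ (2 * m)) =
  (2 * m)`!%:R / (m`!%:R * 2 ^+ m) * Phi (fun A => pairing A F ^+ 2) ^+ m.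
Proof.
rewrite !Phi_power /gauss_coeff oddM/= mul2n doubleK /cexp_coeff expr1 divr1.
have f0 : (m`!%:R : R[i]) != 0 by rewrite pnatr_eq0 -lt0n fact_gt0.
have t0 : (2 ^+ m : R[i]) != 0 by rewrite expf_neq0// pnatr_eq0.
have -> : (2`!%:R : R[i]) = 2 by [].
rewrite [X in _ = _ * X]exprMn.
by field; rewrite f0 t0.
Qed.

End one_direction.

Definition pair_set (T : finType) (kl : T * T) : {set T} := [set kl.1; kl.2]%SET.

(** Ordered pairs of indices are grouped by their underlying set, which brings the quadratic form
    into the shape required by [sum_sign_power]; diagonal pairs land on singletons. *)
Lemma Phi_square_sum (T : finType) (F : T -> Mdual R d) (S : {set T}) :
  (forall k, Mfin (F k)) ->
  Phi (fun A => pairing A (subset_sum F S) ^+ 2) =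
  \sum_(B : {set T} | B \subset S) \sum_(kl : T * T | pair_set kl == B)
    Phi (fun A => pairing A (F kl.1) * pairing A (F kl.2)).
Proof.
move=> finF.
transitivity (\sum_(kl : T * T) ((pair_set kl \subset S)%:R *
    Phi (fun A => pairing A (F kl.1) * pairing A (F kl.2)))).
  rewrite -Phi_sum => [|kl]; last first.
    have := @wick_polynomial_prod bool (fun b => if b then F kl.1 else F kl.2).
    under [X in wick_polynomial X]eq_fun do rewrite big_bool/=.
    by apply; case.
  congr Phi; apply/funext => A; rewrite pairing_subset_sum// expr2 mulr_suml.
  under eq_bigr do rewrite mulr_sumr.
  rewrite pair_big/= big_mkcond; apply: eq_bigr => kl _.
  by rewrite /pair_set finset.subUset !finset.sub1set; case: ifP; rewrite ?mul1r ?mul0r.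
rewrite [RHS](eq_bigr (fun B : {set T} => \sum_(kl : T * T | (pair_set kl \subset S) &&
    (pair_set kl == B))
    Phi (fun A => pairing A (F kl.1) * pairing A (F kl.2)))) => [|B BS].
  rewrite -(partition_big (@pair_set T) (fun B => B \subset S))//=.
  by rewrite [RHS]big_mkcond; apply: eq_bigr => kl _; case: ifP; rewrite ?mul1r ?mul0r.
by apply: eq_bigl => kl; case: eqP => [->|]; rewrite ?BS ?andbF.
Qed.

Lemma sum_pairs_card2 (T : finType) (F : T -> Mdual R d) (B : {set T}) : #|B| = 2%N ->
  \sum_(kl : T * T | pair_set kl == B)
    Phi (fun A => pairing A (F kl.1) * pairing A (F kl.2)) =
  2 * Phi (fun A => \prod_(k in B) pairing A (F k)).
Proof.
move=> /eqP/cards2P[x [y [xy ->]]].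
rewrite (bigD1 (x, y))/= ?eqxx// (bigD1 (y, x))/=; last first.
  by rewrite /pair_set finset.setUC eqxx xpair_eqE negb_and eq_sym xy.
rewrite big1 ?addr0 => [|[k l] /= /andP[/andP[/eqP kl] n1 n2]]; last first.
  exfalso; have xy' := negPf xy; have yx : (y == x) = false by rewrite eq_sym.
  have : k \in [set x; y]%SET by rewrite -kl /pair_set !inE eqxx.
  have : l \in [set x; y]%SET by rewrite -kl /pair_set !inE eqxx orbT.
  have : x \in pair_set (k, l) by rewrite kl !inE eqxx.
  have : y \in pair_set (k, l) by rewrite kl !inE eqxx orbT.
  move: n1 n2; rewrite /pair_set !inE/= !xpair_eqE => n1 n2 yE xE /orP[/eqP lE|/eqP lE]
      /orP[/eqP kE|/eqP kE];
    by move: n1 n2 xE yE; rewrite lE kE ?eqxx ?yx ?xy' /= ?xy' ?yx.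
have E : Phi (fun A => \prod_(k in [set x; y]%SET) pairing A (F k)) =
    Phi (fun A => pairing A (F x) * pairing A (F y)).
  by congr Phi; apply/funext => A; rewrite finset.big_setU1 ?inE//= finset.big_set1.
rewrite E mulrDl mul1r; congr (_ + _).
by congr Phi; apply/funext => A; rewrite mulrC.
Qed.

Lemma Phi_wick (m : nat) (F : 'I_(2 * m) -> Mdual R d) : (forall k, Mfin (F k)) ->
  Phi (fun A => \prod_k pairing A (F k)) =
  \sum_(P : {set {set 'I_(2 * m)}} | block_partition 2 P)
    \prod_(B in P) Phi (fun A => \prod_(k in B) pairing A (F k)).
Proof.
move=> finF; pose T := 'I_(2 * m).
pose c (B : {set T}) := \sum_(kl : T * T | pair_set kl == B)
    Phi (fun A => pairing A (F kl.1) * pairing A (F kl.2)).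
have cT : #|{: T}| = (m * 2)%N by rewrite card_ord mulnC.
have c0 (B : {set T}) : (2 < #|B|)%N -> c B = 0.
  move=> B2; rewrite /c big1// => kl /eqP klB; move: B2.
  by rewrite -klB /pair_set cards2; case: eqP.
under [X in Phi X]eq_fun do rewrite prod_pairing_polarization//.
rewrite Phi_sum => [|S]; last by apply: wick_polynomial_power; exact: Mfin_subset_sum.
have f0 k : (k`!%:R : R[i]) != 0 by rewrite pnatr_eq0 -lt0n fact_gt0.
have t0 : (2 ^+ m : R[i]) != 0 by rewrite expf_neq0// pnatr_eq0.
(* The [(2 m)!] of polarization cancels that of [Phi_power_even]. The remaining [m!] will cancel
   against the orderings of the blocks, and [2^m] against the two orders within each block. *)
transitivity ((m`!%:R * 2 ^+ m)^-1 * \sum_(S : {set T}) (-1) ^+ #|~: S| *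
   (\sum_(B : {set T} | B \subset S) c B) ^+ m).
  rewrite mulr_sumr; apply: eq_bigr => S _.
  rewrite [in Phi _](card_ord (2 * m)) Phi_power_even; last exact: Mfin_subset_sum.
  rewrite Phi_square_sum// card_ord.
  by field; rewrite !f0 t0.
rewrite (sum_sign_power _ cT c0)// invfM mulrACA mulVf// mul1r.
rewrite mulr_sumr; apply: eq_bigr => P PP.
have cP := block_partition_card (isT : 0 < 2)%N cT PP.
rewrite -(@mulKf _ _ t0 (\prod_(B in P) Phi _)); congr (_ * _).
have -> : 2 ^+ m * \prod_(B in P) Phi (fun A => \prod_(k in B) pairing A (F k)) =
    \prod_(B in P) (2 * Phi (fun A => \prod_(k in B) pairing A (F k))).
  by rewrite big_split/= prodr_const cP.
apply: eq_bigr => B BP.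
apply: sum_pairs_card2; case/andP: PP => _ /forall_inP/(_ _ BP)/eqP //.
Qed.

End distribution.
End wick_polynomials.

Unset Implicit Arguments.
Close Scope classical_set_scope.

Theorem theorem4p3 (R : realType) (d : nat)
  (mu : probability (Omega R d) R)
  (W : forall n, Mdual R d -> tensor R d n)
  (Phi : (Mdual R d -> R[i]) -> R[i])
  (Hmu : standard_gaussian mu)
  (HW : wick_monomials W)
  (HPhi : hida_distribution mu W Phi)
  (HT : forall F : Mdual R d, Mfin F ->
    T_transform Phi F =
    cexp (- ('i%C * \sum_(nu < d) mattr (matmul (F (inl nu)) (F (inr nu))))))
  (m : nat) (F : 'I_(2 * m) -> Mdual R d)
  (HF : forall k, Mfin (F k)) :
  Phi (fun A => \prod_(k < 2 * m) pairing A (F k)) =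
  \sum_(P : {set {set 'I_(2 * m)}} | perfect_pairing P)
    \prod_(B in P) Phi (fun A => \prod_(k in B) pairing A (F k)).
Proof.
exact: (Phi_wick Hmu HW HPhi HT HF).
Qed.
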